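(* Let $r,n\ge1$ be integers, let $\alpha\in\mathbb F_{2^r}^\times$, and let $C_{3,\alpha}$ be the curve $y^2+y=\alpha(x^{2^{r+1}+1}+x^{2^r+2}+x^{2^r+1}+x^2)$ over $\mathbb F_{2^r}$. Write $\#C_{3,\alpha}(\mathbb F_{2^{rn}})=(2^{rn}+1)+D$. (1) If $r$ is odd and $x^3+x+\alpha^{-1}$ has three roots in $\mathbb F_{2^r}$, then $D=2^{r(n+1)/2}$ if $n\equiv1,7\pmod 8$; $D=-2^{r(n+1)/2}$ if $n\equiv3,5\pmod 8$; $D=0$ if $n\equiv2,6\pmod 8$; $D=2^{r(n+2)/2+1}$ if $n\equiv4\pmod 8$; $D=-2^{r(n+2)/2+1}$ if $n\equiv0\pmod 8$. (2) If $r$ is even and $x^3+x+\alpha^{-1}$ has three roots in $\mathbb F_{2^r}$, then $D=2^{r(n+1)/2}$ if $n\equiv1,3,5,7\pmod 8$; $D=0$ if $n\equiv2,6\pmod 8$; $D=-2^{r(n+2)/2+1}$ if $n\equiv0,4\pmod 8$. (3) If $r$ is odd and $x^3+x+\alpha^{-1}$ has exactly one root in $\mathbb F_{2^r}$, then $D=2^{r(n+1)/2}$ if $n\equiv1,7\pmod 8$; $D=-2^{r(n+1)/2}$ if $n\equiv3,5\pmod 8$; $D=0$ if $n\equiv2,4,6\pmod 8$; $D=-2^{r(n+2)/2+1}$ if $n\equiv0\pmod 8$. (4) If $r$ is even and $x^3+x+\alpha^{-1}$ has exactly one root in $\mathbb F_{2^r}$, then $D=2^{r(n+1)/2}$ if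 $n\equiv1,3,5,7\pmod 8$; $D=0$ if $n\equiv2,4,6\pmod 8$; $D=-2^{r(n+2)/2+1}$ if $n\equiv0\pmod 8$. (5) If $r$ is odd and $x^3+x+\alpha^{-1}$ has no root in $\mathbb F_{2^r}$, then, with all congruences modulo $24$: $D=2^{r(n+1)/2}$ if $n\equiv1,7,17,23$; $D=-2^{r(n+1)/2}$ if $n\equiv5,11,13,19$; $D=2^{r(n+1)/2+1}$ if $n\equiv3,21$; $D=-2^{r(n+1)/2+1}$ if $n\equiv9,15$; $D=0$ if $n\equiv2,6,10,14,18,22$; $D=-2^{r(n+2)/2}$ if $n\equiv4,20$; $D=2^{r(n+2)/2}$ if $n\equiv8,16$; $D=2^{r(n+2)/2+1}$ if $n\equiv12$; $D=-2^{r(n+2)/2+1}$ if $n\equiv0$. (6) If $r$ is even and $x^3+x+\alpha^{-1}$ has no root in $\mathbb F_{2^r}$, then, with all congruences modulo $24$: $D=2^{r(n+1)/2}$ if $n\equiv1,5,7,11,13,17,19,23$; $D=-2^{r(n+1)/2+1}$ if $n\equiv3,9,15,21$; $D=0$ if $n\equiv2,6,10,14,18,22$; $D=2^{r(n+2)/2}$ if $n\equiv4,8,16,20$; $D=-2^{r(n+2)/2+1}$ if $n\equiv0,12$.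
   Context: $\#C_{3,\alpha}(\mathbb F_{2^{rn}})$ is the number of affine solutions $(x,y)\in\mathbb F_{2^{rn}}^2$ of the equation plus one (for the single point at infinity). *)

(* Defs.v *)
From HB Require Import structures.
From mathcomp Require Import all_boot all_order all_algebra.

Set Implicit Arguments.
Unset Strict Implicit.
Unset Printing Implicit Defensive.

Import GRing.Theory.

Local Open Scope ring_scope.

(* The affine points, over the finite field L, of the curve C_{3,a} :
     y^2 + y = a (x^(2^(r+1)+1) + x^(2^r+2) + x^(2^r+1) + x^2). *)
Definition C3_affine (L : finFieldType) (r : nat) (a : L) : {set L * L} :=
  [set P : L * L |
    P.2 ^+ 2 + P.2 ==
      a * (P.1 ^+ (2 ^ r.+1 + 1) + P.1 ^+ (2 ^ r + 2)
           + P.1 ^+ (2 ^ r + 1) + P.1 ^+ 2)].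

(* The projective curve has a single point at infinity. *)
Definition C3_card (L : finFieldType) (r : nat) (a : L) : nat :=
  (#|C3_affine r a| + 1)%N.

(* The number of distinct roots in F of x^3 + x + a^-1; for a != 0 and F of
   characteristic 2 this polynomial is separable, since its derivative x^2 + 1
   vanishes only at 1, where it takes the value a^-1. *)
Definition cubic_nroots (F : finFieldType) (a : F) : nat :=
  #|[set x : F | root ('X^3 + 'X + (a^-1)%:P) x]|.

(* Main.v *)
Require Import Defs.
From HB Require Import structures.
From mathcomp Require Import all_boot all_order all_algebra.
From mathcomp Require Import all_fingroup all_solvable all_field.
From mathcomp Require Import ring zify.

Set Implicit Arguments.
Unset Strict Implicit.
Unset Printing Implicit Defensive.

Import GRing.Theory.

Local Open Scope ring_scope.

(** Let q = 2^r, let sigma be the Frobenius x |-> x^q of L, put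
    s x = x + sigma x and v = s x, and let psi z = (-1)^(Tr z) be the character
    of L given by the absolute trace. The right-hand side of the curve is
    Q x = a (x^2 v + x v^2) + a x v, whose trace is a quadratic form over F_2,
    and D is the sum of the signs psi (Q x) (C3_cardE).

    Its radical is the set of w with P (s (s w)) = 0 (psi_quadD), where
    P t = a^2 t (t^3 + t + 1/a): this is how the cubic enters. Unless D = 0, its
    square is |L| times the order of the radical (gsum_sqr_card), which depends
    on the parity of n and on which roots of the cubic lie in L. What remains is
    to decide when D = 0, and otherwise to find the sign.

    If n = 2 mod 4, then F_(q^2) lies in the radical and the form takes the
    value one on it, so D = 0 (gsum_2mod4).

    If n = 4k, put tau = sigma^(2k). Averaging over the translations by
    xi + sigma xi + ... + sigma^(2k-1) xi restricts the sum to the x such that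
    P g = P 1, with g = s (x + tau x) (gsum_average). Where g = 1 the sign
    is constant and explicit (rtr_quad_slope1). If the cubic has no root
    in L, then g = 1 is forced, and D is known. If it has a root c in F_q, then
    Q x has the same trace as X s(X) with X = (x^2 + c x) / (c^2 + c), and D
    becomes the sum of two sums of psi (X^(q+1) + d X), with d = 1 and d = 1/c
    (gsum_root_split); the same reduction evaluates each of them, with a sign
    that depends on the traces of 1 and of 1/c.

    If n is odd, or if n is divisible by 12 and the cubic has no root in F_q,
    let p be an odd prime dividing n, with p = 3 in the second case. A group of
    order p generated by a power of sigma acts on L, preserves Q, and fixes the
    subfield K of degree n/p over F_q; so the sums over L and K are congruent
    modulo p (gsum_congr). Since D is up to sign a known power of two, induction
    on n determines it (gsum_odd, gsum_noroot). The powers of two modulo p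
    produce the Jacobi symbol (2/n), and the factor 2 that appears together with
    the roots when 3 divides n has to be -2, because it is one modulo 3.

    Finally the number of roots of the cubic in F_q determines the traces: an
    Artin-Schreier equation governs the roots other than c, hence three roots
    mean Tr (1/c) = Tr 1, and a single root means Tr (1/c) = Tr 1 + 1
    (chi_inv_eq); and without root Tr a = Tr 1 (chi_noroot). *)

(** * Frobenius powers, relative traces and signs in characteristic two *)

(** Locked, so that a power of x never unifies with a Frobenius power. *)
HB.lock Definition frob (R : pzSemiRingType) (e : nat) (x : R) : R :=
  x ^+ (2 ^ e).

(** On the field with 2^(e n) elements this is the trace down to the subfield
    with 2^e elements; e = 1 gives the absolute trace. *)
Definition rtr (R : pzSemiRingType) (e n : nat) (z : R) : R :=
  \sum_(i < n) frob (e * i) z.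

(** The nontrivial character z |-> (-1)^(Tr z) of the field with 2^N elements.
    Keeping N explicit allows the character of a subfield to be evaluated
    inside a larger field. *)
Definition chi (R : pzSemiRingType) (N : nat) (z : R) : int :=
  if rtr 1 N z == 0 then 1 else -1.

Lemma frobE (R : pzSemiRingType) (e : nat) (x : R) : frob e x = x ^+ (2 ^ e).
Proof. by rewrite unlock. Qed.

Lemma frob0e (R : pzSemiRingType) (x : R) : frob 0 x = x.
Proof. by rewrite !frobE expn0 expr1. Qed.

Lemma frob1E (R : pzSemiRingType) (x : R) : frob 1 x = x ^+ 2.
Proof. by rewrite frobE. Qed.

Lemma frob_frob (R : pzSemiRingType) (d e : nat) (x : R) :
  frob d (frob e x) = frob (d + e) x.
Proof. by rewrite !frobE -exprM -expnD addnC. Qed.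

Lemma frobC (R : pzSemiRingType) (d e : nat) (x : R) :
  frob d (frob e x) = frob e (frob d x).
Proof. by rewrite !frob_frob addnC. Qed.

Lemma frobX (R : pzSemiRingType) (e k : nat) (x : R) :
  frob e (x ^+ k) = frob e x ^+ k.
Proof. by rewrite !frobE exprAC. Qed.

Lemma frob_1 (R : pzSemiRingType) (e : nat) : frob e (1 : R) = 1.
Proof. by rewrite !frobE expr1n. Qed.

Lemma frob_iter (R : pzSemiRingType) (e k : nat) (x : R) :
  frob e x = x -> frob (e * k) x = x.
Proof.
move=> ex; elim: k => [|k IHk]; first by rewrite muln0 frob0e.
by rewrite mulnS -frob_frob IHk.
Qed.

Lemma frob_rmorph (R S : pzSemiRingType) (f : {rmorphism R -> S}) (e : nat) x :
  frob e (f x) = f (frob e x).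
Proof. by rewrite !frobE rmorphXn. Qed.

Lemma rtr_rmorph (R S : pzSemiRingType) (f : {rmorphism R -> S}) (e n : nat) x :
  rtr e n (f x) = f (rtr e n x).
Proof.
by rewrite /rtr rmorph_sum; apply: eq_bigr => i _; rewrite frob_rmorph.
Qed.

Lemma chi_rmorph (R S : fieldType) (f : {rmorphism R -> S}) (N : nat) x :
  chi N (f x) = chi N x.
Proof. by rewrite /chi rtr_rmorph fmorph_eq0. Qed.

Section Frobenius.

Variable L : fieldType.
Hypothesis ch2 : 2 \in [pchar L].

Lemma natr_char2 k : k%:R = (odd k)%:R :> L.
Proof.
by rewrite -[in LHS](odd_double_half k) natrD -mul2n natrM (pcharf0 ch2) mul0r
           addr0.
Qed.

Lemma addr_eq0_char2 (x y : L) : (x + y == 0) = (x == y).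
Proof. by rewrite addr_eq0 (oppr_pchar2 ch2). Qed.

Lemma frobD e (x y : L) : frob e (x + y) = frob e x + frob e y.
Proof.
rewrite !frobE exprDn_pchar // pnatX; apply/orP; left.
by rewrite pnatE.
Qed.

Lemma frobM e (x y : L) : frob e (x * y) = frob e x * frob e y.
Proof. by rewrite !frobE exprMn. Qed.

Lemma frobV e (x : L) : frob e x^-1 = (frob e x)^-1.
Proof. by rewrite !frobE exprVn. Qed.

Lemma frob0 e : frob e (0 : L) = 0.
Proof. by rewrite !frobE expr0n expn_eq0. Qed.

Lemma frob_eq0 e (x : L) : (frob e x == 0) = (x == 0).
Proof. by rewrite !frobE expf_eq0 expn_gt0. Qed.

Lemma frob_inj e : injective (@frob L e).
Proof.
move=> x y /eqP; rewrite -addr_eq0_char2 -frobD frob_eq0 addr_eq0_char2.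
by move/eqP.
Qed.

Lemma frob_sum e (I : Type) (s : seq I) (P : pred I) (F : I -> L) :
  frob e (\sum_(i <- s | P i) F i) = \sum_(i <- s | P i) frob e (F i).
Proof. by apply: (big_morph _ (frobD e) (frob0 e)). Qed.

Lemma frob_nat e k : frob e (k%:R : L) = k%:R.
Proof.
elim: k => [|k IHk]; first exact: frob0.
by rewrite -addn1 natrD frobD IHk frob_1.
Qed.

Lemma rtrD e n (x y : L) : rtr e n (x + y) = rtr e n x + rtr e n y.
Proof. by rewrite /rtr -big_split; apply: eq_bigr => i _; rewrite frobD. Qed.

Lemma rtr0 e n : rtr e n (0 : L) = 0.
Proof. by rewrite /rtr big1 // => i _; rewrite frob0. Qed.

Lemma rtrZ e n (c z : L) : frob e c = c -> rtr e n (c * z) = c * rtr e n z.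
Proof.
move=> ec; rewrite /rtr mulr_sumr; apply: eq_bigr => i _.
by rewrite frobM frob_iter.
Qed.

Lemma rtr_const e n (c : L) : frob e c = c -> rtr e n c = n%:R * c.
Proof.
move=> ec; rewrite /rtr (eq_bigr (fun=> c)) => [|i _]; last exact: frob_iter.
by rewrite sumr_const card_ord mulr_natl.
Qed.

Lemma frob_rtr d e n (z : L) : frob d (rtr e n z) = rtr e n (frob d z).
Proof. by rewrite /rtr frob_sum; apply: eq_bigr => i _; rewrite frobC. Qed.

Lemma rtr_addn e n m (z : L) :
  rtr e (n + m) z = rtr e n z + rtr e m (frob (e * n) z).
Proof.
rewrite /rtr big_split_ord /=; congr (_ + _); apply: eq_bigr => i _.
by rewrite frob_frob mulnDr addnC.
Qed.

Lemma rtr_telescope e n (z : L) : rtr e n (z + frob e z) = z + frob (e * n) z.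
Proof.
elim: n => [|n IHn].
  by rewrite /rtr big_ord0 muln0 frob0e (addrr_pchar2 ch2).
rewrite -addn1 rtr_addn IHn {1}/rtr big_ord1 muln0 frob0e frobD frob_frob.
by rewrite -addrA (addKr_pchar2 ch2) mulnDr muln1.
Qed.

Lemma frob_rtr_fix e n (z : L) :
  frob (e * n) z = z -> frob e (rtr e n z) = rtr e n z.
Proof.
move=> ez; apply/eqP; rewrite eq_sym -addr_eq0_char2 frob_rtr -rtrD.
by rewrite rtr_telescope ez addrr_pchar2.
Qed.

Lemma rtr_comp e d n (z : L) : rtr e (d * n) z = rtr e d (rtr (e * d) n z).
Proof.
elim: n => [|n IHn]; first by rewrite muln0 /rtr !big_ord0 [RHS]rtr0.
rewrite mulnS addnC rtr_addn IHn -addn1 rtr_addn rtrD; congr (_ + rtr _ _ _).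
by rewrite /rtr big_ord1 muln0 frob0e mulnA.
Qed.

Lemma rtr_double e n (z : L) :
  rtr e (n + n) z = rtr e n (z + frob (e * n) z).
Proof. by rewrite rtr_addn rtrD. Qed.

Lemma rtr_even e k (z : L) : rtr e (2 * k) z = rtr (e * 2) k (z + frob e z).
Proof.
rewrite rtr_comp rtrD -frob_rtr {1}/rtr big_ord_recl big_ord1 /= muln0 muln1.
by rewrite frob0e.
Qed.

(** Telescoping the absolute trace t of z + z^2 = 0 yields t + t^2 = 0. *)
Lemma rtr1_01 N (z : L) : frob N z = z -> rtr 1 N z = 0 \/ rtr 1 N z = 1.
Proof.
move=> zN; have := rtr_telescope 1 N z.
rewrite mul1n zN (addrr_pchar2 ch2) rtrD -frob_rtr frob1E => /eqP.
rewrite -[X in X + _]mulr1 expr2 -mulrDr mulf_eq0 addrC addr_eq0_char2.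
by case/orP => /eqP ->; [left | right].
Qed.

Lemma chiD N (x y : L) : frob N x = x -> frob N y = y ->
  chi N (x + y) = chi N x * chi N y.
Proof.
move=> xN yN; rewrite /chi rtrD.
case: (rtr1_01 xN) => ->; case: (rtr1_01 yN) => ->;
  by rewrite ?add0r ?addr0 ?(addrr_pchar2 ch2) ?eqxx ?oner_eq0 ?mulr1 ?mul1r.
Qed.

Lemma chi0 N : chi N (0 : L) = 1.
Proof. by rewrite /chi rtr0 eqxx. Qed.

Lemma chi_sqr N (x : L) : chi N x * chi N x = 1.
Proof. by rewrite /chi; case: ifP. Qed.

Lemma chi_frob N e (x : L) : chi N (frob e x) = chi N x.
Proof. by rewrite /chi -frob_rtr frob_eq0. Qed.

Lemma chi_comp e n (z : L) : chi (e * n) z = chi e (rtr e n z).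
Proof. by rewrite /chi rtr_comp mul1n. Qed.

Lemma chi_natmul N k (x : L) : frob N x = x ->
  chi N (k%:R * x) = chi N x ^+ k.
Proof.
move=> xN; elim: k => [|k IHk]; first by rewrite mul0r chi0.
rewrite -addn1 natrD mulrDl mul1r chiD ?IHk ?addn1 ?exprSr //.
by rewrite frobM frob_nat xN.
Qed.

End Frobenius.

(** * Additive characters of a finite field of characteristic two *)

Section Characters.

Variables (L : finFieldType) (N : nat).
Hypothesis cardL : #|L| = (2 ^ N)%N.

Lemma char2_card : 2 \in [pchar L].
Proof. exact: card_finPcharP cardL _. Qed.

Let ch2 := char2_card.

Lemma card_exp_gt0 : (0 < N)%N.
Proof. by have := finNzRing_gt1 L; rewrite cardL; case: N. Qed.

Lemma frob_card (x : L) : frob N x = x.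
Proof. by rewrite frobE -cardL expf_card. Qed.

Lemma chi_add (x y : L) : chi N (x + y) = chi N x * chi N y.
Proof. by rewrite chiD ?frob_card. Qed.

(** The trace is a nonzero polynomial function of degree 2^(N-1) < |L|. *)
Lemma exists_trace_neq0 : exists z : L, rtr 1 N z != 0.
Proof.
pose p : {poly L} := \sum_(i < N) 'X^(2 ^ i).
have hp (z : L) : p.[z] = rtr 1 N z.
  rewrite /p horner_sum; apply: eq_bigr => i _.
  by rewrite hornerXn frobE mul1n.
have p0 : p != 0.
  apply/eqP => /(congr1 (fun u : {poly L} => u`_1)); rewrite coef0 /p coef_sum.
  move/eqP; case: N card_exp_gt0 => [//|M] _.
  rewrite big_ord_recl big1 => [|i _]; rewrite coefXn ?eqxx ?addr0 ?oner_eq0 //.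
  by rewrite lift0 ltn_eqF // -[1%N](expn0 2) ltn_exp2l.
have sp : (size p <= #|L|)%N.
  rewrite cardL; apply: (leq_trans (size_sum _ _ _)); apply/bigmax_leqP => i _.
  by rewrite size_polyXn ltn_exp2l.
case: (pickP (fun z : L => rtr 1 N z != 0)) => [z hz|h]; first by exists z.
have := max_poly_roots p0 (rs := enum L).
rewrite enum_uniq -cardE ltnNge sp => /(_ _ isT) H; suff: false by [].
apply: H; apply/allP => z _; apply/rootP; rewrite hp.
by have := h z; rewrite /= => /negbFE /eqP.
Qed.

Lemma exists_chi_m1 : exists z : L, chi N z = -1.
Proof.
by have [z hz] := exists_trace_neq0; exists z; rewrite /chi (negbTE hz).
Qed.

(** Translating by an element of trace one changes the sign of every term. *)
Lemma sum_chiM (c : L) :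
  \sum_z chi N (z * c) = if c == 0 then (2 ^ N)%:Z else 0.
Proof.
case: eqP => [->|/eqP c0].
  rewrite (eq_bigr (fun=> 1)) => [|z _]; last by rewrite mulr0 chi0.
  by rewrite sumr_const cardL natz.
have [t ht] := exists_chi_m1.
have : \sum_z chi N (z * c) = - \sum_z chi N (z * c).
  rewrite {1}(reindex_inj (addrI (t / c))) /= -sumrN; apply: eq_bigr => z _.
  by rewrite mulrDl divfK // chi_add ht mulN1r.
lia.
Qed.

Lemma sum_chi_sqM (c : L) :
  \sum_z chi N (z ^+ 2 * c) = if c == 0 then (2 ^ N)%:Z else 0.
Proof.
have i2 : injective (fun z : L => z ^+ 2).
  by move=> x y; rewrite -!frob1E => /(frob_inj ch2).
by rewrite -sum_chiM [RHS](reindex_inj i2).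
Qed.

(** Detect y^2 + y = c by summing psi (t (y^2 + y + c)) over t. Summed over y
    first, only t = 0 and t = 1 contribute, as t y and t^2 y^2 have the same
    trace. *)
Lemma card_artin_schreier (c : L) :
  (#|[set y : L | y ^+ 2 + y == c]|)%:Z = 1 + chi N c.
Proof.
have ind (y : L) :
    \sum_t chi N (t * (y ^+ 2 + y + c))
    = if y ^+ 2 + y == c then (2 ^ N)%:Z else 0.
  by rewrite sum_chiM (addr_eq0_char2 ch2).
have : \sum_y \sum_t chi N (t * (y ^+ 2 + y + c))
     = (2 ^ N)%:Z * (#|[set y : L | y ^+ 2 + y == c]|)%:Z.
  rewrite (eq_bigr _ (fun y _ => ind y)) -big_mkcond /= sumr_const cardsE.
  by rewrite -mulr_natr natz.
rewrite exchange_big /=.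
have chg (t : L) : \sum_y chi N (t * (y ^+ 2 + y + c))
    = chi N (t * c) * (if t * (t + 1) == 0 then (2 ^ N)%:Z else 0).
  rewrite -sum_chi_sqM mulr_sumr; apply: eq_bigr => y _.
  have -> : t * (y ^+ 2 + y + c) = t * c + (t * y ^+ 2 + t * y) by ring.
  rewrite !chi_add -[chi N (t * y)](chi_frob ch2 _ 1) frob1E -!chi_add.
  by congr (chi _ _); ring.
rewrite (eq_bigr _ (fun t _ => chg t)) (bigD1 0) //= (bigD1 1) ?oner_neq0 //=.
rewrite !mul0r !mul1r eqxx (addrr_pchar2 ch2) eqxx big1 => [|t /andP[t0 t1]].
  rewrite chi0 => h; apply/eqP; rewrite -(inj_eq (mulfI (_ : (2 ^ N)%:Z != 0))).
    by rewrite -h; apply/eqP; ring.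
  by rewrite eqz_nat expn_eq0.
by rewrite mulf_eq0 (negbTE t0) (addr_eq0_char2 ch2) (negbTE t1) mulr0.
Qed.

Lemma artin_schreier_solvable (c : L) :
  (exists y : L, y ^+ 2 + y = c) <-> chi N c = 1.
Proof.
pose S := [set y : L | y ^+ 2 + y == c].
have hS : (#|S|)%:Z = 1 + chi N c by exact: card_artin_schreier.
split=> [[y hy]|hc].
  have : (0 < #|S|)%N by apply/card_gt0P; exists y; rewrite inE hy.
  by move: hS; rewrite /chi; case: ifP; lia.
have : (0 < #|S|)%N by lia.
by case/card_gt0P => y; rewrite inE => /eqP; exists y.
Qed.

(** The polynomials X^(2^d) - X divide X^(2^N) - X, which splits into distinct
    linear factors over L. *)
Lemma card_frob_fixed d : (d %| N)%N ->
  #|[set x : L | frob d x == x]| = (2 ^ d)%N.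
Proof.
move=> dN; have d0 : (0 < d)%N by apply: dvdn_gt0 dN; apply: card_exp_gt0.
pose p : {poly L} := 'X^(2 ^ d) - 'X.
have sp : size p = (2 ^ d).+1.
  rewrite size_polyDl size_polyXn // size_polyN size_polyX ltnS.
  by rewrite (leq_pexp2l (m := 2) (n1 := 1)).
have root_p (x : L) : root p x = (frob d x == x).
  by rewrite rootE !hornerE subr_eq0 frobE.
have : p %| \prod_(x <- enum L) ('X - x%:P).
  rewrite big_enum -finField_genPoly cardL.
  have XX k : (0 < k)%N ->
      'X^(2 ^ k) - 'X = 'X * ('X^((2 ^ k).-1) - 1) :> {poly L}.
    by move=> k0; rewrite mulrBr mulr1 -exprS prednK ?expn_gt0.
  rewrite /p !XX ?card_exp_gt0 // dvdp_mul2l ?polyX_eq0 //.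
  have [k ->] := dvdnP dN; rewrite mulnC expnM.
  have [j ->] := dvdnP (dvdn_pred_predX (2 ^ d) k).
  by rewrite mulnC exprM [X in _ %| X]subrX1 dvdp_mulIl.
case/dvdp_prod_XsubC => m hm; set s := mask m (enum L) in hm.
have us : uniq s by rewrite mask_uniq // enum_uniq.
have -> : [set x : L | frob d x == x] = [set x in s].
  by apply/setP => x; rewrite !inE -root_p (eqp_root hm) root_prod_XsubC.
rewrite cardsE (card_uniqP us); have := eqp_size hm.
by rewrite sp size_prod_XsubC => -[].
Qed.

End Characters.

(** * Sums of quadratic signs and their radical *)

(* The ring tactic reduces a coefficient modulo an equation only when it is
   the very coefficient of that equation: one rule for each that occurs. *)
Ltac char2_ring ch2 :=
  let h2 := fresh in let h3 := fresh in let h4 := fresh in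
  let h5 := fresh in let h6 := fresh in let h7 := fresh in
  let h8 := fresh in
  have h2 := natr_char2 ch2 2; have h3 := natr_char2 ch2 3;
  have h4 := natr_char2 ch2 4; have h5 := natr_char2 ch2 5;
  have h6 := natr_char2 ch2 6; have h7 := natr_char2 ch2 7;
  have h8 := natr_char2 ch2 8;
  rewrite /= in h2 h3 h4 h5 h6 h7 h8; ring: h2 h3 h4 h5 h6 h7 h8.

Definition delta (L : fieldType) (r : nat) (x : L) : L := x + frob r x.

(** With b = a and c = 0 this is the right-hand side of the curve; with a = 0
    and b = 1 it has the trace of x^(q+1) + d x, where d^2 = 1 + c. The two
    families are needed together since the first reduces to the second when the
    cubic has a root in the base field. *)
Definition quad (L : fieldType) (r : nat) (a b c x : L) : L :=
  a * (x ^+ 2 * delta r x + x * delta r x ^+ 2) + b * (x * delta r x)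
  + c * x ^+ 2.

Definition gsum (L : finFieldType) (r n : nat) (a b c : L) : int :=
  \sum_x chi (r * n) (quad r a b c x).

(** The radical of the form quad consists of the w such that this linearised
    polynomial vanishes at t = delta r (delta r w). *)
Definition radpoly (L : fieldType) (a b t : L) : L :=
  a ^+ 2 * t ^+ 4 + b ^+ 2 * t ^+ 2 + a * t.

Section Additivity.

Variables (L : fieldType) (r : nat) (a b : L).
Hypothesis ch2 : 2 \in [pchar L].
Hypotheses (ar : frob r a = a) (br : frob r b = b).

Lemma deltaD (x y : L) : delta r (x + y) = delta r x + delta r y.
Proof. by rewrite /delta frobD //; ring. Qed.

Lemma frob_delta e (x : L) : frob e (delta r x) = delta r (frob e x).
Proof. by rewrite /delta frobD // frobC. Qed.

Lemma delta_sqr (w : L) : delta r (delta r w) = w + frob (r * 2) w.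
Proof.
by rewrite muln2 -addnn -frob_frob /delta frobD //; char2_ring ch2.
Qed.

Lemma delta_sqr_eq0 (w : L) :
  (delta r (delta r w) == 0) = (frob (r * 2) w == w).
Proof. by rewrite delta_sqr (addr_eq0_char2 ch2) eq_sym. Qed.

Lemma radpolyD (x y : L) : radpoly a b (x + y) = radpoly a b x + radpoly a b y.
Proof. by rewrite /radpoly; char2_ring ch2. Qed.

Lemma frob_quad e c (x : L) : frob r c = c ->
  frob (r * e) (quad r a b c x) = quad r a b c (frob (r * e) x).
Proof.
move=> cr; rewrite /quad /delta !(frobX, frobD ch2, frobM) !(frobC (r * e) r).
by rewrite !(frob_iter e ar, frob_iter e br, frob_iter e cr).
Qed.

Lemma frob_radpoly e (t : L) :
  frob (r * e) (radpoly a b t) = radpoly a b (frob (r * e) t).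
Proof.
have aX : frob (r * e) a = a by apply: frob_iter.
have bX : frob (r * e) b = b by apply: frob_iter.
by rewrite /radpoly !(frobD ch2) !(frobX, frobM) aX bX.
Qed.

End Additivity.

Section QuadraticSums.

Variables (L : finFieldType) (r n : nat) (a b c : L).
Hypothesis cardL : #|L| = (2 ^ (r * n))%N.
Hypotheses (ar : frob r a = a) (br : frob r b = b) (cr : frob r c = c).

Let ch2 : 2 \in [pchar L] := char2_card cardL.
Local Notation psi := (chi (r * n)).
Local Notation Q := (quad r a b c).
Local Notation P := (radpoly a b).
Local Notation s := (delta r).
Local Notation sigma := (frob r).
Local Notation S := (gsum r n a b c).

Let psiF e (z : L) : psi (frob e z) = psi z. Proof. exact: chi_frob. Qed.

(** In the polar form, invariance of the trace under squaring and sigma moves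
    every occurrence of x into a factor (sigma x)^2. *)
Lemma psi_quadD (x w : L) :
  psi (Q (x + w)) = psi (Q x) * psi (Q w) * psi (sigma x ^+ 2 * P (s (s w))).
Proof.
have add := chi_add cardL.
set X := sigma x; set V := s w; set w1 := sigma w; set V1 := sigma V.
have -> : Q (x + w) = Q x + Q w + (a * (x ^+ 2 * V) + (a * (w ^+ 2 * x)
    + (a * (w ^+ 2 * X) + (a * (x * V ^+ 2) + (a * (w * x ^+ 2)
    + (a * (w * X ^+ 2) + (b * (x * V) + (b * (w * x) + b * (w * X))))))))).
  rewrite /quad deltaD // -/V /delta -/X; char2_ring ch2.
rewrite 2![psi (_ + (a * _ + _))]add; congr (_ * _).
  by rewrite -add.
rewrite !add.
rewrite -(psiF r (a * (x ^+ 2 * V))) -(psiF r (a * (w * x ^+ 2))).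
rewrite -(psiF (r + 1) (a * (w ^+ 2 * x))) -(psiF (r + 1) (a * (x * V ^+ 2))).
rewrite -(psiF (r + 1) (b * (x * V))) -(psiF (r + 1) (b * (w * x))).
rewrite -(psiF 1 (a * (w ^+ 2 * X))) -(psiF 1 (b * (w * X))).
rewrite [(r + 1)%N]addnC -!frob_frob !(frobX, frobM).
rewrite ar br -/X -/V1 -/w1.
rewrite !frob1E -!add; congr (chi _ _).
rewrite /radpoly.
have -> : V1 = V + (s V) by rewrite /delta -/V1; char2_ring ch2.
have -> : w1 = V + w by rewrite /V /delta -/w1; char2_ring ch2.
move: (s V) => U; char2_ring ch2.
Qed.

Lemma psi_rtr (z : L) : psi z = chi r (rtr r n z). Proof. exact: chi_comp. Qed.

Lemma gsum_translate (w : L) :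
  S = psi (Q w) * \sum_x psi (Q x) * psi (sigma x ^+ 2 * P (s (s w))).
Proof.
rewrite /gsum (reindex_inj (addIr w)) mulr_sumr; apply: eq_bigr => x _ /=.
by rewrite psi_quadD; ring.
Qed.

Lemma gsum_radical (w : L) : P (s (s w)) = 0 -> S = psi (Q w) * S.
Proof.
move=> w0; rewrite {1}(gsum_translate w); congr (_ * _).
by apply: eq_bigr => x _; rewrite w0 mulr0 chi0 // mulr1.
Qed.

Lemma gsum_eq0 (w : L) : P (s (s w)) = 0 -> psi (Q w) = -1 -> S = 0.
Proof. by move=> /gsum_radical; move=> h w1; move: h; rewrite w1; lia. Qed.

(** In the double sum over x and x + w, the sum over x vanishes unless w is in
    the radical. *)
Lemma gsum_sqr :
  S ^+ 2 = (2 ^ (r * n))%:Z * \sum_(w | P (s (s w)) == 0) psi (Q w).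
Proof.
have -> : S ^+ 2 = \sum_x \sum_w psi (Q x) * psi (Q (x + w)).
  rewrite expr2 {1}/gsum mulr_suml; apply: eq_bigr => x _.
  by rewrite -mulr_sumr; congr (_ * _); rewrite /gsum (reindex_inj (addrI x)).
rewrite exchange_big /= mulr_sumr [RHS]big_mkcond /=; apply: eq_bigr => w _.
transitivity (psi (Q w) * \sum_x psi (sigma x ^+ 2 * P (s (s w)))).
  rewrite mulr_sumr; apply: eq_bigr => x _.
  by rewrite psi_quadD !mulrA chi_sqr mul1r.
rewrite -(reindex_inj (@frob_inj _ ch2 r) (P := predT)
  (F := fun x => psi (x ^+ 2 * P (s (s w))))) /= (sum_chi_sqM cardL).
by case: ifP => _; rewrite ?mulr0 // mulrC.
Qed.

(** Translation by w in the radical multiplies the sum by psi (Q w), which is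
    therefore one when the sum is nonzero. *)
Lemma gsum_sqr_card :
  S != 0 -> S ^+ 2 = (2 ^ (r * n) * #|[set w : L | P (s (s w)) == 0%R]|)%N%:Z.
Proof.
move=> S0; rewrite gsum_sqr (eq_bigr (fun=> 1)) => [|w /eqP /gsum_radical h].
  by rewrite sumr_const natz PoszM cardsE.
by apply: (mulIf S0); rewrite -h mul1r.
Qed.

End QuadraticSums.

(** All of F_(q^2) lies in the radical. There v = w + w^q is in F_q and the form
    has the trace of a v^2 over F_q; for w the trace of xi from L, this is
    the absolute trace of a xi^2: some translation reverses the sign. *)
Lemma gsum_2mod4 (L : finFieldType) r m (a : L) :
  #|L| = (2 ^ (r * (2 * m)))%N -> odd m -> frob r a = a -> a != 0 ->
  gsum r (2 * m) a a 0 = 0.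
Proof.
move=> cardL om ar a0; have ch2 := char2_card cardL.
have [z hz] := exists_chi_m1 cardL.
pose xi := frob (r * (2 * m)).-1 (z / a).
have xi2 : a * xi ^+ 2 = z.
  rewrite -frob1E frob_frob addnC addn1 prednK ?(card_exp_gt0 cardL) //.
  by rewrite (frob_card cardL) mulrC divfK.
pose w := rtr (r * 2) m xi.
have [v vE] : {v | v = delta r w} by exists (delta r w).
have w2 : frob (r * 2) w = w.
  by apply: frob_rtr_fix => //; rewrite -mulnA (frob_card cardL).
have w2' : frob r (frob r w) = w by rewrite frob_frob addnn -muln2.
have rv : frob r v = v by rewrite vE frob_delta // /delta w2' addrC.
have sv : delta r v = 0 by rewrite /delta rv addrr_pchar2.
apply: (gsum_eq0 cardL ar ar (w := w)).
  by rewrite -vE sv /radpoly; ring.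
rewrite psi_rtr // rtr_even //.
have -> : quad r a a 0 w + frob r (quad r a a 0 w) = a * v ^+ 2.
  have fw : frob r w = w + v by rewrite vE /delta; char2_ring ch2.
  have := frob_quad ch2 ar ar 1 w (frob0 L r); rewrite muln1 fw => ->.
  by rewrite /quad deltaD // -vE sv; char2_ring ch2.
have av2 : frob (r * 2) (a * v ^+ 2) = a * v ^+ 2.
  by apply: frob_iter; rewrite frobM frobX ar rv.
rewrite (rtr_const m av2) (natr_char2 ch2) om mul1r.
have -> : v = rtr r (2 * m) xi by rewrite vE rtr_even // rtrD // -frob_rtr.
by rewrite -frob1E frob_rtr // -rtrZ // -psi_rtr // frob1E xi2.
Qed.

(** * Reduction to an affine subspace in degree 4k *)

Section FourK.

Variables (L : finFieldType) (r n m k : nat) (a b c : L).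
Hypothesis cardL : #|L| = (2 ^ (r * n))%N.
Hypotheses (nmm : n = (m + m)%N) (mk : m = (2 * k)%N).
Hypotheses (ar : frob r a = a) (br : frob r b = b) (cr : frob r c = c).

Let ch2 : 2 \in [pchar L] := char2_card cardL.
Local Notation psi := (chi (r * n)).
Local Notation Q := (quad r a b c).
Local Notation P := (radpoly a b).
Local Notation s := (delta r).
Local Notation sigma := (frob r).
Local Notation tau := (frob (r * m)).
(* A norm for addition: s (norm xi) = xi + tau xi. *)
Local Notation norm := (rtr r m).
Local Notation S := (gsum r n a b c).

Let fcard (x : L) : frob (r * n) x = x := frob_card cardL x.

Let psiF e (z : L) : psi (frob e z) = psi z. Proof. exact: chi_frob. Qed.

Let add : forall x y : L, psi (x + y) = psi x * psi y := chi_add cardL.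

Let tau2 (x : L) : tau (tau x) = x.
Proof. by rewrite frob_frob -mulnDr -nmm fcard. Qed.

Definition slope (x : L) : L := s (x + tau x).

(** With u = norm xi and v = s u, the trace y of xi satisfies tau u = u + y,
    tau v = v and norm v = y: the cubic terms cancel in a (y^2 y + y y^2). *)
Lemma psi_quad_rtr (xi : L) : psi (Q (norm xi)) = psi (b * xi ^+ 2).
Proof.
have [u uE] : {u | u = norm xi} by exists (norm xi).
have [v vE] : {v | v = s u} by exists (s u).
have [y yE] : {y | y = rtr r n xi} by exists (rtr r n xi).
have vN : v = xi + tau xi.
  by rewrite vE uE /delta frob_rtr // -rtrD // rtr_telescope.
have tu : tau u = u + y.
  by rewrite yE nmm rtr_addn uE frob_rtr // (addKr_pchar2 ch2).
have tv : tau v = v by rewrite vN frobD // tau2 addrC.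
have ry : sigma y = y by rewrite yE; apply: frob_rtr_fix.
have sy : s y = 0 by rewrite /delta ry addrr_pchar2.
have Nv : norm v = y by rewrite vN yE nmm rtr_double.
rewrite !(psi_rtr cardL) -uE {1}nmm (rtr_double ch2).
have -> : Q u + tau (Q u)
    = (a * y ^+ 2) * v + ((a * y) * v ^+ 2 + ((b * y) * v + c * y ^+ 2)).
  rewrite frob_quad // tu /quad deltaD // sy -vE; char2_ring ch2.
have fix2 (d e : L) : sigma d = d -> sigma e = e -> sigma (d * e) = d * e.
  by move=> dr er; rewrite frobM dr er.
have ry2 : sigma (y ^+ 2) = y ^+ 2 by rewrite frobX ry.
rewrite !(rtrD ch2) (rtrZ _ _ (fix2 _ _ ar ry2)) (rtrZ _ _ (fix2 _ _ ar ry)).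
rewrite (rtrZ _ _ (fix2 _ _ br ry)) (rtr_const _ (fix2 _ _ cr ry2)).
rewrite (rtrZ _ _ br) -!frob1E -!frob_rtr // Nv -yE !frob1E.
rewrite (natr_char2 ch2) mk mul2n odd_double mul0r.
by congr (chi _ _); char2_ring ch2.
Qed.

Lemma psi_slope_adjoint (x xi : L) :
  psi (sigma x ^+ 2 * P (s (xi + tau xi))) = psi (slope x ^+ 2 * P xi).
Proof.
have [e eE] : {e | e = P xi} by exists (P xi).
have sP (t : L) : sigma (P t) = P (sigma t).
  by have := frob_radpoly ch2 ar br 1 t; rewrite muln1.
have -> : P (s (xi + tau xi)) = e + sigma e + (tau e + sigma (tau e)).
  rewrite /delta !radpolyD // -sP !radpolyD // -frob_radpoly // -eE frobD //.
  by ring.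
have -> : sigma x ^+ 2 * (e + sigma e + (tau e + sigma (tau e)))
    = sigma x ^+ 2 * e + sigma x ^+ 2 * sigma e
      + (sigma x ^+ 2 * tau e + sigma x ^+ 2 * sigma (tau e)) by ring.
rewrite !add -eE -frobX -!frobM !psiF.
rewrite -[psi (x ^+ 2 * tau e)](psiF (r * m)).
rewrite -[psi (sigma (x ^+ 2) * tau e)](psiF (r * m)).
rewrite !(frobX, frobM) !tau2 -!add; congr (chi _ _).
by rewrite /slope /delta !(frobD ch2) (frobC r); char2_ring ch2.
Qed.

(** Up to squares the argument is xi^2 (P g + b). *)
Lemma sum_psi_slope (g : L) :
  \sum_xi psi (b * xi ^+ 2) * psi (g ^+ 2 * P xi)
  = if P g == b then (2 ^ (r * n))%:Z else 0.
Proof.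
rewrite -(addr_eq0_char2 ch2) -(sum_chi_sqM cardL); apply: eq_bigr => xi _.
have -> : g ^+ 2 * P xi
    = (g * a * xi ^+ 2) ^+ 2 + (g ^+ 2 * b ^+ 2 * xi ^+ 2 + g ^+ 2 * a * xi).
  by rewrite /radpoly; ring.
rewrite !add -(frob1E (g * a * _)) psiF -(psiF 1 (g ^+ 2 * a * xi)) frob1E.
rewrite -!add.
by congr (chi _ _); rewrite /radpoly; ring.
Qed.

(** Average the sum over the translations by norm xi: the average over xi of the
    resulting factor is one where P (slope x) = b and zero elsewhere. *)
Lemma gsum_average : S = \sum_(x | P (slope x) == b) psi (Q x).
Proof.
have : (2 ^ (r * n))%:Z * S = \sum_xi \sum_x psi (Q (x + norm xi)).
  rewrite (eq_bigr (fun=> S)) => [|xi _]; last first.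
    by rewrite /gsum [RHS](reindex_inj (addIr (norm xi))).
  by rewrite sumr_const cardL -mulr_natl natz.
rewrite exchange_big /=.
have inner (x : L) : \sum_xi psi (Q (x + norm xi))
    = psi (Q x) * (if P (slope x) == b then (2 ^ (r * n))%:Z else 0).
  rewrite -sum_psi_slope mulr_sumr; apply: eq_bigr => xi _.
  rewrite (psi_quadD _ cardL ar br) -mulrA psi_quad_rtr -psi_slope_adjoint.
  congr (_ * (_ * psi (_ * P (s _)))).
  by rewrite /delta frob_rtr // -rtrD // rtr_telescope.
rewrite (eq_bigr _ (fun x _ => inner x)).
rewrite [in RHS](bigID (fun x => P (slope x) == b)) /=.
rewrite [X in _ + X]big1 => [|x /negbTE ->]; last by rewrite mulr0.
rewrite addr0 (eq_bigr (fun x => (2 ^ (r * n))%:Z * psi (Q x))); last first.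
  by move=> x ->; rewrite mulrC.
by rewrite -mulr_sumr; apply: mulfI; rewrite eqz_nat expn_eq0.
Qed.

(** The trace to F_q is the composite of 1 + tau, 1 + sigma and the sum of the
    sigma^(2i) for i < k. The first two turn the form into a polynomial in Y and
    u = s (s x); the last one is linear over F_(q^2), which contains Y, and maps
    u = x + sigma^2 x to Y by telescoping. *)
Lemma rtr_quad_slope1 (x : L) : slope x = 1 ->
  let Y := x + tau x in
  sigma Y = Y + 1
  /\ rtr r n (Q x) = (a + b) * (Y ^+ 2 + Y) + k%:R * (b + c).
Proof.
move=> sl /=; have [Y YE] : {Y | Y = x + tau x} by exists (x + tau x).
have sY : s Y = 1 by rewrite YE.
have fY : sigma Y = Y + 1 by rewrite -sY /delta; char2_ring ch2.
rewrite -YE; split=> //.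
have [v vE] : {v | v = s x} by exists (s x).
have [u uE] : {u | u = s v} by exists (s v).
have fx : sigma x = x + v by rewrite vE /delta; char2_ring ch2.
have fv : sigma v = v + u by rewrite uE /delta; char2_ring ch2.
have tx : tau x = x + Y by rewrite YE; char2_ring ch2.
have s1 : s (1 : L) = 0 by rewrite /delta frob_1 addrr_pchar2.
have fQ (z : L) : sigma (Q z) = Q (sigma z).
  by have := frob_quad ch2 ar br 1 z cr; rewrite muln1.
have -> : rtr r n (Q x) = rtr (r * 2) k ((a * Y ^+ 2) * u + ((a * Y) * u ^+ 2
    + (a * u ^+ 2 + (a * u + (b * Y * u + (b * u + (b + c))))))).
  rewrite nmm (rtr_double ch2) mk (rtr_even ch2) -mk; congr (rtr _ _ _).
  rewrite frob_quad // tx frobD // !fQ frobD // fx fY.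
  rewrite /quad !deltaD // -vE -uE sY s1 addr0; char2_ring ch2.
have r2 (d : L) : sigma d = d -> frob (r * 2) d = d by apply: frob_iter.
have Y2 : frob (r * 2) Y = Y.
  by rewrite muln2 -addnn -frob_frob fY frobD // frob_1 fY; char2_ring ch2.
have fix2 (d e : L) : frob (r * 2) d = d -> frob (r * 2) e = e ->
    frob (r * 2) (d * e) = d * e by move=> dr er; rewrite frobM dr er.
have Y22 : frob (r * 2) (Y ^+ 2) = Y ^+ 2 by rewrite frobX Y2.
have Eu : rtr (r * 2) k u = Y.
  have -> : u = x + frob (r * 2) x.
    by rewrite muln2 -addnn -frob_frob uE vE /delta frobD //; char2_ring ch2.
  by rewrite rtr_telescope // -mulnA -mk.
rewrite !(rtrD ch2) (rtrZ _ _ (fix2 _ _ (r2 _ ar) Y22)) (rtr_const _ (r2 _ br)).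
rewrite (rtr_const _ (r2 _ cr)).
rewrite (rtrZ _ _ (fix2 _ _ (r2 _ ar) Y2)) (rtrZ _ _ (fix2 _ _ (r2 _ br) Y2)).
rewrite !(rtrZ _ _ (r2 _ ar)) !(rtrZ _ _ (r2 _ br)) -(frob1E u) -frob_rtr // Eu.
by rewrite frob1E; char2_ring ch2.
Qed.

(** The sum is e times the number of x of slope one, and this number is
    obtained from the square of the sum rather than by solving the equation. *)
Lemma gsum_slope1 (e : int) :
    (forall g, (P g == b) = (g == 1)) ->
    (forall x, slope x = 1 -> psi (Q x) = e) -> e * e = 1 ->
  S = e * (2 ^ (r * m.+1))%:Z.
Proof.
move=> P1 he ee.
have ST : S = e * (#|[set x : L | slope x == 1]|)%:Z.
  rewrite gsum_average (eq_bigl _ _ (fun x => P1 (slope x))).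
  rewrite (eq_bigr (fun=> e)) => [|x /eqP /he //].
  by rewrite sumr_const -mulr_natr natz cardsE.
have P0 (t : L) : (P t == 0) = (t == 0).
  rewrite -[t == 0](inj_eq (addIr 1)) add0r -P1 radpolyD //.
  have /eqP -> : P 1 == b by rewrite P1.
  by rewrite -[P t == 0](inj_eq (addIr b)) /= add0r.
have : S ^+ 2 = ((2 ^ (r * m.+1)) * (2 ^ (r * m.+1)))%N%:Z.
  rewrite (gsum_sqr c cardL ar br) (eq_bigl _ _ (fun w => P0 (s (s w)))).
  rewrite (eq_bigl _ _ (delta_sqr_eq0 r ch2)).
  rewrite (eq_bigr (fun=> 1)) => [|w /eqP w2].
    rewrite sumr_const natz -cardsE (card_frob_fixed cardL); last first.
      by rewrite nmm mk -mulnDr mulnA dvdn_mulr.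
    rewrite -PoszM -!expnD; congr (Posz (2 ^ _)); rewrite nmm; ring.
  rewrite (psi_rtr cardL) nmm (rtr_double ch2) frob_quad //.
  by rewrite mk mulnA (frob_iter _ w2) addrr_pchar2 // rtr0 chi0.
rewrite ST; set T := #|_| => h; congr (_ * _).
have {h} : (T * T = (2 ^ (r * m.+1)) * (2 ^ (r * m.+1)))%N.
  apply/eqP; rewrite -eqz_nat -h PoszM; apply/eqP.
  by rewrite expr2 mulrACA ee mul1r.
by move/eqP; rewrite !mulnn eqn_sqr => /eqP ->.
Qed.

End FourK.

(** * The substitution attached to a root in the base field *)

Definition cubic_root (L : fieldType) (a z : L) : bool :=
  z ^+ 3 + z + a^-1 == 0.

Lemma radpoly_cubic (L : fieldType) (a z : L) : a != 0 ->
  (radpoly a a z == 0) = (z == 0) || cubic_root a z.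
Proof.
move=> a0; have -> : radpoly a a z = a ^+ 2 * (z * (z ^+ 3 + z + a^-1)).
  by rewrite /radpoly; field.
by rewrite !mulf_eq0 /= (negbTE a0).
Qed.

Section Cubic.

Variables (L : fieldType) (a c : L).
Hypotheses (ch2 : 2 \in [pchar L]) (a0 : a != 0) (ac : cubic_root a c).

Lemma cubic_root_neq0 : c != 0.
Proof.
apply: contraL ac => /eqP ->; rewrite /cubic_root expr0n /= !add0r.
by rewrite invr_eq0.
Qed.

Lemma cubic_root_inv : a^-1 = c * (c + 1) ^+ 2.
Proof.
move: ac; rewrite /cubic_root (addr_eq0_char2 ch2) => /eqP <-.
by char2_ring ch2.
Qed.

Lemma cubic_root_neq1 : c + 1 != 0.
Proof.
apply: contraNneq (_ : a^-1 != 0) => [c1|]; last by rewrite invr_eq0.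
by rewrite cubic_root_inv c1 expr0n mulr0.
Qed.

End Cubic.

Section RootSplit.

Variables (L : finFieldType) (r n : nat) (a c : L).
Hypothesis cardL : #|L| = (2 ^ (r * n))%N.
Hypotheses (a0 : a != 0) (cr : frob r c = c) (ac : cubic_root a c).

Let ch2 : 2 \in [pchar L] := char2_card cardL.
Local Notation psi := (chi (r * n)).

Lemma sum_artin_schreier (G : L -> int) :
  \sum_y G (y ^+ 2 + y) = \sum_z (1 + psi z) * G z.
Proof.
rewrite (partition_big (fun y => y ^+ 2 + y) predT) //=; apply: eq_bigr => z _.
rewrite (eq_bigr (fun=> G z)) => [|y /eqP -> //].
by rewrite sumr_const -(card_artin_schreier cardL) -cardsE -mulr_natl natz.
Qed.

(** Since 1/a = c (c + 1)^2, substituting x = c y and X = c / (c + 1) (y^2 + y)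
    turns the form into X s(X). The values X are those for which
    psi ((1 + 1/c) X) = 1, whence two sums, without and with that factor. *)
Lemma gsum_root_split :
  gsum r n a a 0 = gsum r n (0 : L) 1 0 + gsum r n 0 1 ((1 + c^-1) ^+ 2).
Proof.
have c0 : c != 0 := cubic_root_neq0 a0 ac.
have c1 : c + 1 != 0 := cubic_root_neq1 ch2 a0 ac.
have aE : a = (c * (c + 1) ^+ 2)^-1 by rewrite -(cubic_root_inv ch2 ac) invrK.
have [i iE] : {i | i = (c + 1)^-1} by exists (c + 1)^-1.
have ci : (c + 1) * i = 1 by rewrite iE mulfV.
have [e eE] : {e | e = c * i} by exists (c * i).
have e0 : e != 0 by rewrite eE iE mulf_neq0 // invr_eq0.
have eV : e^-1 = 1 + c^-1 by rewrite eE iE invfM invrK mulrDr mulr1 mulVf.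
have er : frob r e = e.
  by rewrite eE iE frobM frobV (frobD ch2) cr frob_1.
have ac2 : a * c ^+ 2 = c * i ^+ 2 by rewrite aE iE; field; rewrite c0 c1.
have e2 : e ^+ 2 + e = c * i ^+ 2.
  by rewrite -[X in _ + X]mulr1 -ci eE; char2_ring ch2.
have key (y : L) :
    psi (quad r a a 0 (c * y)) = psi (quad r 0 1 0 (e * (y ^+ 2 + y))).
  have dM (d z : L) : frob r d = d -> delta r (d * z) = d * delta r z.
    by move=> dr; rewrite /delta frobM dr mulrDr.
  rewrite /quad !dM // deltaD // -[in delta r (y ^+ 2)]frob1E -frob_delta //.
  move: (delta r y) => w; rewrite frob1E.
  have -> : a * ((c * y) ^+ 2 * (c * w) + c * y * (c * w) ^+ 2)
      + a * (c * y * (c * w)) + 0 * (c * y) ^+ 2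
      = e ^+ 2 * (y ^+ 2 * w + y * w ^+ 2 + y * w) + e * y * w.
    transitivity ((a * c ^+ 2) * (c * (y ^+ 2 * w + y * w ^+ 2) + y * w)).
      by ring.
    have -> : e * y * w = (e ^+ 2 + e) * (y * w) + e ^+ 2 * (y * w).
      by char2_ring ch2.
    by rewrite ac2 e2 eE; char2_ring ch2.
  rewrite (chi_add cardL) -[psi (e * y * w)](chi_frob ch2 _ 1) frob1E.
  by rewrite -(chi_add cardL); congr (chi _ _); ring.
rewrite {1}/gsum (reindex_inj (mulfI c0)) /= (eq_bigr _ (fun y _ => key y)).
rewrite (sum_artin_schreier (fun z => psi (quad r 0 1 0 (e * z)))).
rewrite (reindex_inj (mulfI (_ : e^-1 != 0))) ?invr_eq0 //=.
rewrite /gsum -big_split; apply: eq_bigr => x _ /=.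
rewrite mulVKf // mulrDl mul1r; congr (_ + _).
rewrite -(chi_frob ch2 _ 1 (e^-1 * x)) -(chi_add cardL) frob1E eV.
by congr (chi _ _); rewrite /quad; ring.
Qed.

End RootSplit.

(** * Values in degree 4k *)

Section FourKSums.

Variables (L : finFieldType) (r k : nat).
Hypothesis cardL : #|L| = (2 ^ (r * (4 * k)))%N.

Let ch2 : 2 \in [pchar L] := char2_card cardL.
Let n4 : (4 * k = 2 * k + 2 * k)%N. Proof. by lia. Qed.

Lemma gsum_quadratic_4k (c : L) : frob r c = c ->
  gsum r (4 * k) 0 1 c = - chi r (1 + c) ^+ k * (2 ^ (r * (2 * k).+1))%:Z.
Proof.
move=> cr; have f0 : frob r (0 : L) = 0 := frob0 L r.
have f1 : frob r (1 : L) = 1 := frob_1 L r.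
apply: (gsum_slope1 cardL n4 (erefl _) f0 f1 cr) => [g|x sl|]; last first.
- by rewrite mulrNN -exprMn chi_sqr expr1n.
- have [fY] := rtr_quad_slope1 cardL n4 (erefl _) f0 f1 cr sl.
  rewrite (psi_rtr cardL) => ->; move: (x + _) fY => Y fY.
  have c1r : frob r (1 + c) = 1 + c by rewrite frobD // f1 cr.
  have fYY : frob r (Y ^+ 2 + Y) = Y ^+ 2 + Y.
    by rewrite frobD // frobX fY; char2_ring ch2.
  rewrite add0r mul1r chiD //; last by rewrite frobM frob_nat // c1r.
  rewrite chi_natmul // -mulN1r; congr (_ * _).
  rewrite /chi addrC -frob1E rtr_telescope // mul1n fY addrA addrr_pchar2 //.
  by rewrite add0r oner_eq0.
have -> : radpoly 0 1 g = g ^+ 2 by rewrite /radpoly; ring.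
rewrite -(addr_eq0_char2 ch2) -[RHS](addr_eq0_char2 ch2).
have -> : g ^+ 2 + 1 = (g + 1) ^+ 2 by char2_ring ch2.
by rewrite expf_eq0.
Qed.

Lemma gsum_root_4k (a c : L) : a != 0 -> frob r c = c -> cubic_root a c ->
  gsum r (4 * k) a a 0
  = - (chi r (1 : L) ^+ k + chi r c^-1 ^+ k) * (2 ^ (r * (2 * k).+1))%:Z.
Proof.
move=> a0 cr ac; have f1 : frob r (1 : L) = 1 := frob_1 L r.
rewrite (gsum_root_split cardL a0 cr ac).
rewrite !gsum_quadratic_4k ?frob0 //; last first.
  by rewrite frobX frobD // f1 frobV cr.
have -> : 1 + (1 + c^-1) ^+ 2 = frob 1 c^-1 by rewrite frob1E; char2_ring ch2.
by rewrite chi_frob // addr0 opprD mulrDl.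
Qed.

Lemma gsum_noroot_4k (a : L) : a != 0 -> frob r a = a ->
    (forall z : L, ~~ cubic_root a z) ->
  gsum r (4 * k) a a 0 = chi r a ^+ k * (2 ^ (r * (2 * k).+1))%:Z.
Proof.
move=> a0 ar noz; have f0 : frob r (0 : L) = 0 := frob0 L r.
apply: (gsum_slope1 cardL n4 (erefl _) ar ar f0) => [g|x sl|]; last first.
- by rewrite -exprMn chi_sqr expr1n.
- have [_] := rtr_quad_slope1 cardL n4 (erefl _) ar ar f0 sl.
  rewrite (psi_rtr cardL) => ->.
  by rewrite addrr_pchar2 // mul0r add0r addr0 chi_natmul.
rewrite -(addr_eq0_char2 ch2) -[RHS](addr_eq0_char2 ch2).
have -> : radpoly a a g + a = radpoly a a (g + 1).
  by rewrite /radpoly; char2_ring ch2.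
by rewrite radpoly_cubic // (negbTE (noz _)) orbF.
Qed.

End FourKSums.

(** * Roots of the cubic and the radical *)

Section CubicRoots.

Variables (L : fieldType) (a : L).
Hypotheses (ch2 : 2 \in [pchar L]) (a0 : a != 0).

(** The sum of the roots is zero. *)
Lemma cubic_root_third (z w : L) :
  cubic_root a z -> cubic_root a w -> z != w ->
  cubic_root a (z + w)
  /\ forall t, cubic_root a t -> [\/ t = z, t = w | t = z + w].
Proof.
rewrite /cubic_root => /eqP hz /eqP hw zw.
have e2 : z ^+ 2 + z * w + w ^+ 2 = 1.
  apply/eqP; rewrite -(addr_eq0_char2 ch2).
  rewrite -(mulrI_eq0 _ (mulfI (_ : z + w != 0))) ?(addr_eq0_char2 ch2) //.
  apply/eqP; transitivity ((z ^+ 3 + z + a^-1) + (w ^+ 3 + w + a^-1)).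
    by char2_ring ch2.
  by rewrite hz hw addr0.
have fact (t : L) : t ^+ 3 + t + a^-1 = (t + z) * (t + w) * (t + (z + w)).
  have -> : a^-1 = z ^+ 3 + z.
    by apply/esym/eqP; rewrite -(addr_eq0_char2 ch2) hz.
  transitivity (t ^+ 3 + t * 1 + (z ^+ 3 + z * 1)); first by ring.
  by rewrite -e2; char2_ring ch2.
split=> [|t]; first by rewrite fact (addrr_pchar2 ch2) mulr0.
rewrite fact !mulf_eq0 -orbA !(addr_eq0_char2 ch2).
by case/or3P => /eqP; [constructor 1 | constructor 2 | constructor 3].
Qed.

Variable r : nat.
Hypotheses (ar : frob r a = a).

Lemma cubic_root_frob (z : L) : cubic_root a z -> cubic_root a (frob r z).
Proof.
rewrite /cubic_root => /eqP hz.
by rewrite -{1}ar -frobV -frobX -!(frobD ch2) hz frob0.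
Qed.

Hypothesis nofix : forall c : L, frob r c = c -> ~~ cubic_root a c.

(** Frobenius permutes the roots without fixed point, hence cyclically, and the
    roots sum to zero. *)
Lemma cubic_root_orbit (z : L) :
  cubic_root a z -> frob (r * 2) z = z + frob r z.
Proof.
move=> hz; have hf := cubic_root_frob hz.
have zf : z != frob r z.
  by apply: contraTneq hz => /esym /nofix.
have [hs third] := cubic_root_third hz hf zf.
rewrite muln2 -addnn -frob_frob.
case: (third _ (cubic_root_frob hf)) => // h.
- have /nofix : frob r (z + frob r z) = z + frob r z.
    by rewrite frobD // h addrC.
  by rewrite hs.
- by move/(frob_inj ch2): h => h; rewrite h eqxx in zf.
Qed.

Lemma cubic_root_frob3 (z : L) : cubic_root a z -> frob (r * 3) z = z.
Proof.
move=> hz; rewrite mulnSr addnC -frob_frob cubic_root_orbit // frobD //.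
rewrite frob_frob addnn -muln2 cubic_root_orbit //; char2_ring ch2.
Qed.

Lemma cubic_root_dvd3 n (z : L) :
  cubic_root a z -> frob (r * n) z = z -> (3 %| n)%N.
Proof.
move=> hz; rewrite /dvdn {1}(divn_eq n 3) mulnDr addnC -frob_frob mulnCA.
rewrite [(_ * (r * 3))%N]mulnC (frob_iter _ (cubic_root_frob3 hz)).
have := ltn_mod n 3; case: (n %% 3)%N => [//|[|[|//]]] _.
  by rewrite muln1 => /nofix; rewrite hz.
rewrite cubic_root_orbit // => /eqP.
rewrite -[X in _ == X]addr0 (inj_eq (addrI z)) frob_eq0 => /eqP z0.
by have := cubic_root_neq0 a0 hz; rewrite z0 eqxx.
Qed.

End CubicRoots.

(** A root z in the algebraic closure satisfies z^(q^3) = z, hence z^(q^n) = z,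
    and so belongs to L. *)
Lemma cubic_root_exists (L : finFieldType) r n (a : L) :
    #|L| = (2 ^ (r * n))%N -> (3 %| n)%N -> a != 0 -> frob r a = a ->
    (forall c : L, frob r c = c -> ~~ cubic_root a c) ->
  exists z : L, cubic_root a z.
Proof.
move=> cardL n3 a0 ar nofix; have ch2 := char2_card cardL.
have [M [f _]] := countable_algebraic_closure L.
have ch2M : 2 \in [pchar M] by rewrite (fmorph_pchar f).
have inL (w : M) : frob (r * n) w = w -> exists w', w = f w'.
  move=> hw; have /(congr1 (fun p => (map_poly f p).[w])) := finField_genPoly L.
  rewrite rmorphB /= map_polyXn map_polyX !hornerE cardL -frobE hw subrr.
  rewrite rmorph_prod horner_prod => /esym /eqP /prodf_eq0 [x _].
  rewrite rmorphB /= map_polyX map_polyC !hornerE subr_eq0 => /eqP ->.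
  by exists x.
have rootL (w' : L) : cubic_root (f a) (f w') = cubic_root a w'.
  by rewrite /cubic_root -fmorphV -rmorphXn -!rmorphD fmorph_eq0.
have far : frob r (f a) = f a by rewrite frob_rmorph ar.
have fa0 : f a != 0 by rewrite fmorph_eq0.
have nofixM (c : M) : frob r c = c -> ~~ cubic_root (f a) c.
  move=> cr; have [w' cE] := inL c (frob_iter n cr).
  by move: cr; rewrite cE frob_rmorph rootL => /fmorph_inj /nofix.
pose p : {poly M} := 'X^3 + 'X + ((f a)^-1)%:P.
have sp : size p != 1.
  have : size p = 4.
    rewrite /p -addrA size_polyDl size_polyXn //.
    rewrite (leq_ltn_trans (size_polyD _ _)) // size_polyX size_polyC.
    by case: eqP.
  by move->.
have /closed_rootP [z] := sp; rewrite rootE !hornerE => hz.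
have [w' zE] : exists w', z = f w'.
  apply: inL; have [j ->] := dvdnP n3; rewrite mulnCA mulnC.
  by apply: frob_iter; apply: cubic_root_frob3 nofixM _ hz.
by exists w'; rewrite -rootL -zE.
Qed.

Section Radical.

Variables (L : finFieldType) (r n : nat) (a : L).
Hypothesis cardL : #|L| = (2 ^ (r * n))%N.
Hypotheses (a0 : a != 0) (ar : frob r a = a).

Let ch2 : 2 \in [pchar L] := char2_card cardL.
Local Notation s := (delta r).
Local Notation K := [set w : L | s (s w) == 0].
Local Notation W := [set w : L | radpoly a a (s (s w)) == 0].

Let fcard (x : L) : frob (r * n) x = x := frob_card cardL x.

Lemma card_delta_kernel : #|K| = (2 ^ (if odd n then r else r * 2))%N.
Proof.
have KE w : (w \in K) = (frob (r * 2) w == w).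
  by rewrite inE delta_sqr_eq0.
case: ifP => [on|/negbT en].
  rewrite -(card_frob_fixed cardL) ?dvdn_mulr //; apply: eq_card => w.
  rewrite KE inE; apply/eqP/eqP => [w2|w1]; last exact: frob_iter.
  rewrite -{2}(fcard w) -(odd_double_half n) on add1n mulnS -frob_frob -mul2n.
  by rewrite mulnA frob_iter.
rewrite -(card_frob_fixed cardL); last by rewrite dvdn_mul ?dvdn2.
by apply: eq_card => w; rewrite KE inE.
Qed.

Lemma radical_trivial :
    (forall w, cubic_root a (s w) -> s w = 0) -> W = K.
Proof.
move=> h; apply/setP => w; rewrite !inE radpoly_cubic //.
by case: eqP => //= sw; apply/negbTE/negP => /h.
Qed.

(** A nonzero z = s (s w) with P z = 0 has trace zero, so it is not in F_q as n
    is odd; then sigma z = z + c is the third root, so that z is in F_(q^2),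
    hence in F_q after all. *)
Lemma radical_root_odd (c : L) :
  odd n -> frob r c = c -> cubic_root a c -> W = K.
Proof.
move=> on cr ac; apply: radical_trivial => w; set z := s w => hz.
have trz : rtr r n z = 0 by rewrite rtr_telescope // fcard addrr_pchar2.
have zr : frob r z != z.
  apply: contraTneq hz => /(rtr_const n); rewrite trz (natr_char2 ch2) on mul1r.
  by move=> <-; apply: contraL (eqxx (0 : L)) => /(cubic_root_neq0 a0).
have cz : c != z by apply: contraNneq zr => <-; rewrite cr.
have [hs third] := cubic_root_third ch2 ac hz cz.
case: (third _ (cubic_root_frob ch2 ar hz)) => h.
- by move: cz; rewrite -{1}cr in h; move/(frob_inj ch2): h => ->; rewrite eqxx.
- by rewrite h eqxx in zr.
have z2 : frob (r * 2) z = z.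
  by rewrite muln2 -addnn -frob_frob h frobD // cr h; char2_ring ch2.
case/eqP: zr; rewrite -{2}(fcard z) -(odd_double_half n) on add1n mulnS.
by rewrite -frob_frob -mul2n mulnA frob_iter.
Qed.

(** If no root is fixed by Frobenius, the roots sum to zero over an orbit,
    whence s (s (z^(q^2))) = z: all four values of s (s w) are attained. *)
Lemma card_radical_noroot (z : L) :
    (forall c : L, frob r c = c -> ~~ cubic_root a c) -> cubic_root a z ->
  #|W| = (4 * #|K|)%N.
Proof.
move=> nofix hz; pose Z := [set t : L | radpoly a a t == 0].
have ZE t : (t \in Z) = (t == 0) || cubic_root a t by rewrite inE radpoly_cubic.
have hf := cubic_root_frob ch2 ar hz.
have zf : z != frob r z by apply: contraTneq hz => /esym /nofix.
have [hs third] := cubic_root_third ch2 hz hf zf.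
have z0 := cubic_root_neq0 a0 hz; have f0 := cubic_root_neq0 a0 hf.
have s0 := cubic_root_neq0 a0 hs.
have -> : #|W| = (#|Z| * #|K|)%N.
  rewrite -sum1_card (partition_big (fun w => s (s w)) (mem Z)) /=; last first.
    by move=> w; rewrite !inE.
  rewrite -sum_nat_const; apply: eq_bigr => t tZ.
  have ft : s (s (frob (r * 2) t)) = t.
    move: (tZ); rewrite ZE => /orP[/eqP ->|ht].
      by rewrite frob0 /delta !(frob0, addr0).
    rewrite (delta_sqr r ch2) (cubic_root_orbit ch2 ar nofix ht).
    rewrite frobD // (frobC (r * 2)) (cubic_root_orbit ch2 ar nofix ht).
    rewrite frobD //.
    rewrite frob_frob addnn -muln2 (cubic_root_orbit ch2 ar nofix ht).
    by char2_ring ch2.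
  rewrite -sum1_card (reindex_inj (addIr (frob (r * 2) t))) /=.
  apply: eq_bigl => w; rewrite !inE (deltaD r ch2 w) (deltaD r ch2 (s w)) ft.
  rewrite -[X in _ && (_ == X)]add0r (inj_eq (addIr t)).
  case: (s (s w) =P 0) => [->|]; rewrite ?andbF // add0r.
  by move: tZ; rewrite inE => ->.
have -> : Z = [set 0; z; frob r z; z + frob r z].
  apply/setP => t; rewrite ZE !inE -!orbA; congr (_ || _).
  apply/idP/or3P => [/third[] ->|]; rewrite ?eqxx; try by constructor.
  by case=> /eqP ->.
have zs : z != z + frob r z.
  by rewrite -[X in X == _]addr0 (inj_eq (addrI z)) eq_sym.
have fs : frob r z != z + frob r z.
  by rewrite -[X in X == _]add0r (inj_eq (addIr _)) eq_sym.
rewrite -!setUA !cardsU1 cards1 !inE !(eq_sym 0) (negbTE z0) (negbTE f0).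
by rewrite (negbTE s0) (negbTE zf) (negbTE zs) (negbTE fs).
Qed.

End Radical.

(** * Subfields and congruences *)

Section FrobFixed.

Variables (L : fieldType) (d : nat) (ch2 : 2 \in [pchar L]).

(** Closure under addition requires characteristic two; a proof of it is kept as
    a parameter so that instances can be inferred from the predicate. *)
Definition frob_fixed (_ : 2 \in [pchar L]) : {pred L} :=
  fun x => frob d x == x.

Fact frob_fixed_divring_closed : divring_closed (frob_fixed ch2).
Proof.
split=> [|x y /eqP fx /eqP fy|x y /eqP fx /eqP fy]; apply/eqP.
- exact: frob_1.
- by rewrite (oppr_pchar2 ch2) frobD // fx fy.
- by rewrite frobM frobV fx fy.
Qed.

HB.instance Definition _ := GRing.isDivringClosed.Build L (frob_fixed ch2)
  frob_fixed_divring_closed.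

End FrobFixed.

Section FixedField.

Variables (L : finFieldType) (d : nat) (ch2 : 2 \in [pchar L]).

Inductive fixed_field := FixedField x & x \in frob_fixed d ch2.
Definition fixed_field_val u := let: FixedField x _ := u in x.

HB.instance Definition _ := [isSub for fixed_field_val].
HB.instance Definition _ := [Finite of fixed_field by <:].
HB.instance Definition _ := [SubChoice_isSubComUnitRing of fixed_field by <:].
HB.instance Definition _ :=
  [SubComUnitRing_isSubIntegralDomain of fixed_field by <:].
HB.instance Definition _ := [SubIntegralDomain_isSubField of fixed_field by <:].

End FixedField.

Lemma frob_subfield (L : finFieldType) N d :
    #|L| = (2 ^ N)%N -> (d %| N)%N ->
  exists (K : finFieldType) (j : {rmorphism K -> L}),
    #|K| = (2 ^ d)%N /\ forall x, frob d x = x -> exists y, x = j y.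
Proof.
move=> cardL dN; have ch2 := char2_card cardL.
exists (fixed_field d ch2), \val.
split=> [|x /eqP fx]; last by exists (FixedField fx).
rewrite -(card_frob_fixed cardL dN) -(card_imset predT val_inj).
apply: eq_card => x; rewrite inE; apply/imsetP/idP => [[u _ ->]|fx].
  exact: valP u.
by exists (FixedField fx).
Qed.

(** The Frobenius power generates a group of order dividing p. *)
Lemma card_frob_stable (L : finFieldType) e p (A : {set L}) :
    #|L| = (2 ^ (e * p))%N -> prime p ->
    (forall x, (frob e x \in A) = (x \in A)) ->
  #|A| = #|[set x in A | frob e x == x]| %[mod p].
Proof.
move=> cardL pp stA; have ch2 := char2_card cardL.
pose f := perm (@frob_inj L ch2 e); pose G := <[f]>%g.
have pG : (p.-group G)%g.
  have fp : (f ^+ p = 1)%g.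
    apply/permP => x; rewrite permX perm1; transitivity (frob (e * p) x).
      elim: p {pp cardL} => [|p IHp] /=; first by rewrite muln0 frob0e.
      by rewrite IHp permE frob_frob mulnS.
    exact: frob_card cardL x.
  by apply: (pnat_dvd (n := p)); rewrite ?pnat_id // -orderE order_dvdn fp.
have actA : [acts G, on A | 'P].
  rewrite cycle_subG; apply/astabsP => x.
  by rewrite /= /aperm permE stA.
rewrite (pgroup_fix_mod pG actA) afix_cycle.
congr (_ %% _)%N; apply: eq_card => x; rewrite !inE; congr (_ && _).
by rewrite sub1set inE /= /aperm permE.
Qed.

Lemma sum_signs (T : finType) (F : T -> int) :
    (forall x, F x = 1 \/ F x = -1) ->
  \sum_x F x = (#|[set x | F x == 1]|)%:Z - (#|[set x | F x == -1]|)%:Z.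
Proof.
move=> F1.
have cnt e : (#|[set x | F x == e]|)%:Z = \sum_x (F x == e)%:R.
  rewrite -natz -sumr_const big_mkcond; apply: eq_bigr => x _.
  by rewrite inE; case: (F x == e).
by rewrite !cnt -sumrB; apply: eq_bigr => x _; case: (F1 x) => ->.
Qed.

(** On the subfield K the traces from L and from K agree, the degree p of L over
    K being odd. *)
Lemma gsum_congr (L K : finFieldType) (j : {rmorphism K -> L}) r k p
    (a b c : K) :
    #|L| = (2 ^ (r * (p * k)))%N -> #|K| = (2 ^ (r * k))%N ->
    (forall x, frob (r * k) x = x -> exists y, x = j y) ->
    prime p -> odd p -> frob r a = a -> frob r b = b -> frob r c = c ->
  (gsum r (p * k) (j a) (j b) (j c) = gsum r k a b c %[mod p])%Z.
Proof.
move=> cardL cardK jK pp op ar br cr; have ch2 := char2_card cardL.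
have ch2K := char2_card cardK.
have jar : frob r (j a) = j a by rewrite frob_rmorph ar.
have jbr : frob r (j b) = j b by rewrite frob_rmorph br.
have jcr : frob r (j c) = j c by rewrite frob_rmorph cr.
have jQ y : quad r (j a) (j b) (j c) (j y) = j (quad r a b c y).
  by rewrite /quad /delta frob_rmorph !(rmorphD, rmorphM, rmorphXn).
have chiJ (y : K) : chi (r * (p * k)) (j y) = chi (r * k) y.
  have -> : (r * (p * k) = (r * k) * p)%N by rewrite mulnCA mulnC.
  rewrite chi_comp //; transitivity (chi (r * k) (j (rtr (r * k) p y))).
    by congr (chi _ _); apply: rtr_rmorph.
  rewrite chi_rmorph rtr_const ?(frob_card cardK) //.
  by rewrite (natr_char2 ch2K) op mul1r.
pose AL e := [set x : L | chi (r * (p * k)) (quad r (j a) (j b) (j c) x) == e].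
pose AK e := [set y : K | chi (r * k) (quad r a b c y) == e].
have sumL : gsum r (p * k) (j a) (j b) (j c) = (#|AL 1|)%:Z - (#|AL (-1)|)%:Z.
  by apply: sum_signs => x; rewrite /chi; case: ifP; [left | right].
have sumK : gsum r k a b c = (#|AK 1|)%:Z - (#|AK (-1)|)%:Z.
  by apply: sum_signs => x; rewrite /chi; case: ifP; [left | right].
have AA e : #|AL e| = #|AK e| %[mod p].
  rewrite (@card_frob_stable _ (r * k) p) //; first last.
  - by move=> x; rewrite !inE -frob_quad // chi_frob.
  - by rewrite cardL; congr (2 ^ _)%N; ring.
  congr (_ %% _)%N; rewrite -(card_imset (AK e) (fmorph_inj j)).
  apply: eq_card => x; rewrite !inE; apply/andP/imsetP => [[he /eqP fx]|[y]].
    have [y xE] := jK x fx; exists y => //.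
    by move: he; rewrite xE jQ chiJ inE.
  by rewrite inE => he ->; rewrite jQ chiJ frob_rmorph (frob_card cardK).
rewrite sumL sumK; apply/eqP; rewrite eqz_mod_dvd.
have AZ e : (p %| (#|AL e|)%:Z - (#|AK e|)%:Z)%Z.
  by rewrite -eqz_mod_dvd !modz_nat AA.
have -> : (#|AL 1|)%:Z - (#|AL (-1)|)%:Z - ((#|AK 1|)%:Z - (#|AK (-1)|)%:Z)
    = ((#|AL 1|)%:Z - (#|AK 1|)%:Z) - ((#|AL (-1)|)%:Z - (#|AK (-1)|)%:Z).
  by ring.
by rewrite rpredB // AZ.
Qed.

(** * The quadratic character of two *)

(** The Jacobi symbol (2/n), for n odd. *)
Definition jacobi2 (n : nat) : int :=
  if (n %% 8)%N \in [:: 1; 7]%N then 1 else -1.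

Lemma odd_mod8 n : odd n -> (n %% 8)%N \in [:: 1; 3; 5; 7]%N.
Proof. by rewrite !inE; lia. Qed.

Lemma jacobi2M m n : odd m -> odd n -> jacobi2 (m * n) = jacobi2 m * jacobi2 n.
Proof.
move=> /odd_mod8 hm /odd_mod8 hn; rewrite /jacobi2 -modnMm.
move: hm hn; rewrite !inE.
by case/or4P => /eqP ->; case/or4P => /eqP ->.
Qed.

Lemma jacobi2_sqr n : jacobi2 n * jacobi2 n = 1.
Proof. by rewrite /jacobi2; case: ifP. Qed.

(** Raise (1 + i)^2 = 2 i to the power (p - 1) / 2 in characteristic p, where
    (1 + i)^p = 1 + i^p. *)
Lemma exp2_half_prime p : prime p -> odd p ->
  ((2 ^+ p./2)%R = jacobi2 p %[mod p])%Z.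
Proof.
move=> pp op; have [M [f _]] := countable_algebraic_closure 'F_p.
have chM : p \in [pchar M] by rewrite (fmorph_pchar f) pchar_Fp.
have n2 : 2%:R != 0 :> M.
  by rewrite -(dvdn_pcharf chM) gtnNdvd // odd_prime_gt2.
have [i i2] : exists i : M, i ^+ 2 = -1.
  have /closed_rootP [i] : size ('X^2 + 1 : {poly M}) != 1.
    by rewrite size_polyDl size_polyXn // size_poly1.
  by rewrite rootE !hornerE addr_eq0 => /eqP; exists i.
have pE : p = (p./2.*2.+1)%N by rewrite -[LHS]odd_double_half op.
have h8 : p./2 = (4 * (p %/ 8) + (p %% 8)./2)%N by lia.
have i4 : i ^+ 4 = 1 by rewrite -[4%N]/(2 * 2)%N exprM i2 sqrrN expr1n.
have ip : i ^+ p = i ^+ (p %% 8).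
  rewrite {1}(divn_eq p 8) exprD mulnC -[8%N]/(4 * 2)%N -mulnA exprM i4 expr1n.
  by rewrite mul1r.
have ih : i ^+ p./2 = i ^+ (p %% 8)./2.
  by rewrite h8 exprD exprM i4 expr1n mul1r.
have i1 : (1 + i) ^+ 2 = 2%:R * i by rewrite sqrrD i2 expr1n; ring.
have i0 : i != 0.
  apply: contraTneq (oner_neq0 M) => i0.
  by rewrite -oppr_eq0 -i2 i0 expr0n eqxx.
have i1n0 : 1 + i != 0.
  have : (1 + i) ^+ 2 != 0 by rewrite i1 mulf_neq0.
  by rewrite expf_eq0.
have key : (1 + i) * i ^+ (p %% 8)./2 * 2%:R ^+ p./2 = 1 + i ^+ (p %% 8).
  rewrite -ip -ih -[X in X + i ^+ p](expr1n _ p) -exprDn_pchar ?pnatE //.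
  by rewrite [in RHS]pE exprS -mul2n exprM i1 exprMn; ring.
have X0 : (1 + i) * i ^+ (p %% 8)./2 != 0 by rewrite mulf_neq0 // expf_neq0.
have res : (2 ^+ p./2 - jacobi2 p)%:~R = 0 :> M.
  rewrite rmorphB rmorphXn /= -[2%:~R]/(2%:R).
  apply/eqP; rewrite subr_eq0; apply/eqP; apply: (mulfI X0); rewrite key.
  by move: (odd_mod8 op); rewrite /jacobi2 !inE; case/or4P => /eqP -> /=;
    ring: i2.
apply/eqP; rewrite eqz_mod_dvd /=.
move: res; set z := _ - _; case: z => z.
  by move/eqP; rewrite -(dvdn_pcharf chM).
by rewrite NegzE rmorphN => /eqP; rewrite oppr_eq0 -(dvdn_pcharf chM) rpredN.
Qed.

(** S = T or S = -T, and an odd prime does not divide 2 T. *)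
Lemma eq_of_sqr_congr (S T : int) p M :
    prime p -> odd p -> (S = T %[mod p])%Z -> T * T = (2 ^ M)%:Z ->
    (S != 0 -> S ^+ 2 = T * T) ->
  S = T.
Proof.
move=> pp op /eqP; rewrite eqz_mod_dvd => pST TT SS.
have pT : ~~ (p %| 2 * T)%Z.
  apply/negP => h; have : (p %| (2 * T) * (2 * T))%Z by apply: dvdz_mulr.
  have -> : 2 * T * (2 * T) = (2 ^ M.+2)%:Z by rewrite !expnS !PoszM -TT; ring.
  rewrite dvdzE /= (Euclid_dvdX _ _ pp) dvdn_prime2 // andbT => /eqP p2.
  by rewrite p2 in op.
have [S0|S0] := eqVneq S 0.
  case/negP: pT; rewrite mulrC; apply: dvdz_mulr.
  by rewrite -rpredN -sub0r -S0.
have /eqP : S ^+ 2 - T * T = 0 by rewrite SS // subrr.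
have -> : S ^+ 2 - T * T = (S - T) * (S + T) by ring.
rewrite mulf_eq0 subr_eq0 => /orP[/eqP // | /eqP ST].
case/negP: pT; have -> : 2 * T = (S + T) - (S - T) by ring.
by rewrite ST sub0r rpredN.
Qed.

(** * Signs by descent along odd primes *)

(** The cubic has a root in the subfield with 2^r elements. *)
Definition rooted (L : finFieldType) (r : nat) (a : L) : bool :=
  [exists c : L, (frob r c == c) && cubic_root a c].

(** In odd degree, and in degree 4k without root in F_q, this is the quotient of
    the sum by a signed power of q. It is -2 rather than 2 when the three roots
    lie in L but not in F_q, since it has to be congruent to one modulo 3. *)
Definition root_coef (b : bool) (n : nat) : int :=
  if ~~ b && (3 %| n)%N then -2 else 1.

Lemma root_coef_congr b p k : prime p ->
  (root_coef b (p * k) = root_coef b k %[mod p])%Z.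
Proof.
move=> pp; rewrite /root_coef Euclid_dvdM //.
have [->|p3] := eqVneq p 3; last first.
  by rewrite [(3 %| p)%N]dvdn_prime2 // eq_sym (negbTE p3).
by rewrite dvdnn /=; case: b; case: (3 %| k)%N.
Qed.

Lemma root_coef_sqr b n : exists e, root_coef b n ^+ 2 = (2 ^ e)%:Z.
Proof. by rewrite /root_coef; case: ifP; [exists 2%N | exists 0%N]. Qed.

Lemma signed_power_sqr (c e : int) M : e * e = 1 ->
  c * e * 2 ^+ M * (c * e * 2 ^+ M) = c ^+ 2 * (2 ^ (M + M))%:Z.
Proof.
move=> ee; rewrite -[(2 ^ _)%:Z]natz natrX exprD.
transitivity (c ^+ 2 * (e * e) * (2 ^+ M * 2 ^+ M)); first by ring.
by rewrite ee mulr1.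
Qed.

Lemma rooted_rmorph (L K : finFieldType) (j : {rmorphism K -> L}) r k
    (a : K) :
  (forall x, frob (r * k) x = x -> exists y, x = j y) ->
  rooted r (j a) = rooted r a.
Proof.
move=> jK; have jroot c : cubic_root (j a) (j c) = cubic_root a c.
  by rewrite /cubic_root -fmorphV -rmorphXn -!rmorphD fmorph_eq0.
apply/existsP/existsP => [[c /andP[/eqP fc ac]]|[c /andP[/eqP fc ac]]].
  have [y cE] := jK c (frob_iter k fc); exists y.
  rewrite -jroot -cE ac andbT; apply/eqP; apply: (fmorph_inj j).
  by rewrite -frob_rmorph -cE.
by exists (j c); rewrite frob_rmorph fc eqxx jroot.
Qed.

Section Evaluation.

Variables (L : finFieldType) (r n : nat) (a : L).
Hypothesis cardL : #|L| = (2 ^ (r * n))%N.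
Hypotheses (a0 : a != 0) (ar : frob r a = a).

Let ch2 : 2 \in [pchar L] := char2_card cardL.

Lemma not_rooted : ~~ rooted r a ->
  forall c : L, frob r c = c -> ~~ cubic_root a c.
Proof.
rewrite negb_exists => /forallP h c cr; have := h c.
by rewrite cr eqxx.
Qed.

Lemma cubic_root_dvd3_card (z : L) :
  ~~ rooted r a -> cubic_root a z -> (3 %| n)%N.
Proof.
move=> nr hz.
exact: (cubic_root_dvd3 ch2 a0 ar (not_rooted nr) hz (frob_card cardL z)).
Qed.

Lemma gsum_sqr_value : odd n || ~~ rooted r a -> gsum r n a a 0 != 0 ->
  gsum r n a a 0 ^+ 2
  = root_coef (rooted r a) n ^+ 2
    * (2 ^ (r * n + if odd n then r else r * 2))%:Z.
Proof.
move=> on S0; rewrite (gsum_sqr_card cardL ar ar S0) expnD !PoszM mulrCA.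
congr (_ * _); rewrite /root_coef.
have [rt|nr] := boolP (rooted r a) => /=.
  case/existsP: (rt) => c /andP[/eqP fc ac].
  rewrite rt orbF in on.
  rewrite (radical_root_odd cardL a0 ar on fc ac) (card_delta_kernel cardL).
  by rewrite on expr1n mul1r.
have nofix := not_rooted nr.
case: ifP => n3.
  have [z hz] := cubic_root_exists cardL n3 a0 ar nofix.
  rewrite (card_radical_noroot cardL a0 ar nofix hz).
  by rewrite (card_delta_kernel cardL).
rewrite radical_trivial // ?(card_delta_kernel cardL) ?expr1n ?mul1r // => w.
by move/(cubic_root_dvd3_card nr); rewrite n3.
Qed.

Lemma gsum_descent p k : prime p -> odd p -> n = (p * k)%N ->
  exists (K : finFieldType) (b : K),
    [/\ #|K| = (2 ^ (r * k))%N, b != 0 & frob r b = b]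
    /\ [/\ rooted r b = rooted r a, chi r b = chi r a
         & ((gsum r n a a 0)%R = (gsum r k b b 0)%R %[mod p])%Z].
Proof.
move=> pp op nE; have cardLp := cardL; rewrite nE in cardLp *.
have [K [j [cardK jK]]] : exists (K : finFieldType) (j : {rmorphism K -> L}),
    #|K| = (2 ^ (r * k))%N /\ forall x, frob (r * k) x = x -> exists y, x = j y.
  by apply: (frob_subfield cardLp); rewrite mulnCA dvdn_mull.
have [b aE] := jK a (frob_iter k ar); exists K, b.
have fb : frob r b = b by apply: (fmorph_inj j); rewrite -frob_rmorph -aE.
split; split=> //.
- by apply: contraNneq a0 => b0; rewrite aE b0 rmorph0.
- by rewrite aE (rooted_rmorph _ jK).
- by rewrite aE; symmetry; apply: chi_rmorph.
rewrite aE -(rmorph0 j); apply: gsum_congr => //; exact: frob0.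
Qed.

End Evaluation.

Lemma eqz_modM d (m1 n1 m2 n2 : int) : (m1 = n1 %[mod d])%Z ->
  (m2 = n2 %[mod d])%Z -> (m1 * m2 = n1 * n2 %[mod d])%Z.
Proof. by move=> h1 h2; rewrite -modzMm h1 h2 modzMm. Qed.

Lemma eqz_modX d (m n : int) k : (m = n %[mod d])%Z ->
  (m ^+ k = n ^+ k %[mod d])%Z.
Proof. by move=> h; rewrite -modzXm h modzXm. Qed.

Lemma jacobi2_exp_odd m k : odd k -> jacobi2 m ^+ k = jacobi2 m.
Proof.
move=> ok; rewrite -(odd_double_half k) ok add1n exprS -muln2 mulnC exprM expr2.
by rewrite jacobi2_sqr expr1n mulr1.
Qed.

Lemma exp2_odd_congr p k r : prime p -> odd p -> odd k ->
  ((2 ^+ (r * (p * k).+1./2))%R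
   = (jacobi2 p ^+ r * 2 ^+ (r * k.+1./2))%R %[mod p])%Z.
Proof.
move=> pp op ok.
have -> : (r * (p * k).+1./2 = p./2 * (k * r) + r * k.+1./2)%N.
  have -> : ((p * k).+1./2 = p./2 * k + k.+1./2)%N by nia.
  by ring.
rewrite exprD exprM; apply: eqz_modM => //.
rewrite -[in RHS](jacobi2_exp_odd p ok) -[in RHS]exprM.
by apply: eqz_modX; apply: exp2_half_prime.
Qed.

Lemma half_succ_odd n : odd n -> (n.+1./2 + n.+1./2 = n.+1)%N.
Proof. by lia. Qed.

(** In degree one the form vanishes. In degree n = p k the square of the sum is
    known, and its sign is read modulo p off the value in degree k. *)
Lemma gsum_odd n (L : finFieldType) r (a : L) :
    odd n -> #|L| = (2 ^ (r * n))%N -> a != 0 -> frob r a = a ->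
  gsum r n a a 0
  = root_coef (rooted r a) n * jacobi2 n ^+ r * 2 ^+ (r * n.+1./2).
Proof.
elim/ltn_ind: n L a => n IHn L a on cardL a0 ar.
have [n1|n1] := leqP n 1.
  have nE : n = 1%N by apply/eqP; rewrite eqn_leq n1 odd_gt0.
  rewrite nE in cardL *.
  rewrite /gsum (eq_bigr (fun=> 1)) => [|x _]; last first.
    have ch2 := char2_card cardL.
    have dx : delta r x = 0.
      by rewrite /delta; have := frob_card cardL x; rewrite muln1 => ->;
         rewrite addrr_pchar2.
    rewrite /quad dx (_ : _ + _ = 0) ?chi0 //; ring.
  rewrite sumr_const cardL /root_coef andbF /jacobi2 /= expr1n !mul1r natrX.
  by rewrite muln1.
pose p := pdiv n; have pp : prime p by apply: pdiv_prime.
have [k nE] : exists k, n = (p * k)%N.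
  by have /dvdnP[k ->] := pdiv_dvd n; exists k; rewrite mulnC.
have [op ok] : odd p /\ odd k by move: on; rewrite nE oddM => /andP.
have kn : (k < n)%N by rewrite nE ltn_Pmull ?prime_gt1 ?odd_gt0.
have [K [b [[cardK b0 br] [rb _ Sb]]]] := gsum_descent cardL a0 ar pp op nE.
have IHb := IHn k kn K b ok cardK b0 br.
have [e c2] := root_coef_sqr (rooted r a) n.
have TT : (root_coef (rooted r a) n * jacobi2 n ^+ r * 2 ^+ (r * n.+1./2))
    * (root_coef (rooted r a) n * jacobi2 n ^+ r * 2 ^+ (r * n.+1./2))
    = root_coef (rooted r a) n ^+ 2 * (2 ^ (r * n + r))%:Z.
  rewrite signed_power_sqr; last by rewrite -exprMn jacobi2_sqr expr1n.
  by congr (_ * Posz (2 ^ _)); rewrite -mulnDr half_succ_odd // mulnS addnC.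
apply: (@eq_of_sqr_congr _ _ p _ pp op _ (etrans TT _)); first last.
- by move=> S0; rewrite (gsum_sqr_value cardL) ?on // TT.
- by rewrite c2 -PoszM -expnD.
rewrite Sb IHb rb nE jacobi2M // exprMn.
have -> : root_coef (rooted r a) (p * k) * (jacobi2 p ^+ r * jacobi2 k ^+ r)
    * 2 ^+ (r * (p * k).+1./2) = root_coef (rooted r a) (p * k) * jacobi2 k ^+ r
    * (jacobi2 p ^+ r * 2 ^+ (r * (p * k).+1./2)) by ring.
apply: eqz_modM.
  by apply: eqz_modM => //; rewrite root_coef_congr.
have -> : 2 ^+ (r * k.+1./2)
    = jacobi2 p ^+ r * (jacobi2 p ^+ r * 2 ^+ (r * k.+1./2)).
  by rewrite mulrA -exprMn jacobi2_sqr expr1n mul1r.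
by apply: eqz_modM => //; symmetry; apply: exp2_odd_congr.
Qed.

(** If 3 does not divide n the cubic has no root in L either; otherwise the sign
    is read modulo 3 off the value in degree n / 3, as 4 = 1 modulo 3. *)
Lemma gsum_noroot k (L : finFieldType) r (a : L) :
    #|L| = (2 ^ (r * (4 * k)))%N -> a != 0 -> frob r a = a -> ~~ rooted r a ->
  gsum r (4 * k) a a 0
  = root_coef false (4 * k) * chi r a ^+ k * 2 ^+ (r * (2 * k).+1).
Proof.
elim/ltn_ind: k L a => k IHk L a cardL a0 ar nr.
have [k3|k3] := boolP (3 %| k)%N; last first.
  have n3 : (3 %| 4 * k)%N = false by rewrite Gauss_dvdr // (negbTE k3).
  rewrite (gsum_noroot_4k cardL a0 ar) => [|z].
    by rewrite /root_coef n3 mul1r -[(2 ^ _)%:Z]natz natrX.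
  by apply/negP => /(cubic_root_dvd3_card cardL a0 ar nr); rewrite n3.
have [j kE] : exists j, k = (3 * j)%N.
  by have /dvdnP[j ->] := k3; exists j; rewrite mulnC.
have nE : (4 * k = 3 * (4 * j))%N by rewrite kE; ring.
have k0 : (0 < k)%N.
  by have := card_exp_gt0 cardL; rewrite !muln_gt0 => /and3P[].
have jk : (j < k)%N by rewrite kE in k0 *; lia.
have [K [b [[cardK b0 br] [rb cb Sb]]]] :=
  @gsum_descent _ _ _ _ cardL a0 ar 3 _ isT isT nE.
have IHb := IHk j jk K b cardK b0 br; rewrite rb cb in IHb.
have ee : chi r a ^+ k * chi r a ^+ k = 1 by rewrite -exprMn chi_sqr expr1n.
have [e c2] := root_coef_sqr false (4 * k).
have TT := signed_power_sqr (root_coef false (4 * k)) (r * (2 * k).+1) ee.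
apply: (@eq_of_sqr_congr _ _ 3 _ isT isT _ (etrans TT _)); first last.
- move=> S0; rewrite (gsum_sqr_value cardL) ?nr ?orbT //.
  rewrite (negbTE nr) oddM /= TT.
  by congr (_ * Posz (2 ^ _)); ring.
- by rewrite c2 -PoszM -expnD.
rewrite Sb (IHb nr) nE; apply: eqz_modM.
  apply: eqz_modM; first by rewrite root_coef_congr.
  by rewrite kE exprM exprS expr2 chi_sqr mulr1.
have -> : (r * (2 * k).+1 = r * (2 * j).+1 + 2 * (r * (2 * j)))%N.
  by rewrite kE; ring.
rewrite exprD -[in LHS](mulr1 (2 ^+ _)); apply: eqz_modM => //.
rewrite exprM -[in LHS](expr1n _ (r * (2 * j))); exact: eqz_modX.
Qed.

(** * Traces attached to the roots *)

Section CubicTraces.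

Variables (F : finFieldType) (r : nat).
Hypothesis cardF : #|F| = (2 ^ r)%N.

Let ch2 : 2 \in [pchar F] := char2_card cardF.

Lemma chi_one : chi r (1 : F) = if odd r then -1 else 1.
Proof.
rewrite /chi rtr_const ?frob_1 // mulr1 (natr_char2 ch2).
by case: (odd r); rewrite ?eqxx ?oner_eq0.
Qed.

(** Dividing the cubic by X + c and scaling by c leaves the Artin-Schreier
    equation t^2 + t = 1 + 1/c^2 for the other roots c t. *)
Lemma chi_inv_eq (a c : F) : a != 0 -> cubic_root a c ->
  chi r c^-1 = chi r (1 : F) <-> exists2 w, cubic_root a w & w != c.
Proof.
move=> a0 ac; have c0 := cubic_root_neq0 a0 ac.
have c1 := cubic_root_neq1 ch2 a0 ac.
have eq1 : chi r c^-1 = chi r (1 : F) <-> chi r (1 + (c ^+ 2)^-1) = 1.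
  rewrite (chi_add cardF) -exprVn -frob1E chi_frob // /chi.
  by do 2!case: ifP => _; split.
rewrite eq1 -(artin_schreier_solvable cardF).
have quad_root (w : F) :
    (w ^+ 2 + w * c + (c ^+ 2 + 1)) * (w + c) = w ^+ 3 + w + a^-1.
  have -> : a^-1 = c ^+ 3 + c.
    by apply/esym/eqP; rewrite -(addr_eq0_char2 ch2) (eqP ac).
  by char2_ring ch2.
split=> [[t ht]|[w aw wc]].
  exists (c * t).
    rewrite /cubic_root -quad_root.
    have -> : (c * t) ^+ 2 + c * t * c + (c ^+ 2 + 1)
        = c ^+ 2 * (t ^+ 2 + t) + (c ^+ 2 + 1) by ring.
    have -> : c ^+ 2 * (t ^+ 2 + t) = c ^+ 2 + 1 by rewrite ht; field.
    by rewrite addrr_pchar2 // mul0r.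
  apply: contraNneq c1 => ct; have t1 : t = 1.
    by apply: (mulfI c0); rewrite mulr1.
  have : (c ^+ 2)^-1 = 1.
    have : 1 + (c ^+ 2)^-1 = 0 by rewrite -ht t1 expr1n addrr_pchar2.
    by move/eqP; rewrite (addr_eq0_char2 ch2) => /eqP.
  move=> /(congr1 (fun z => z^-1)); rewrite invrK invr1 => c2.
  have -> : (c + 1 == 0) = ((c + 1) ^+ 2 == 0) by rewrite expf_eq0.
  have -> : (c + 1) ^+ 2 = c ^+ 2 + 1 by char2_ring ch2.
  by rewrite c2 addrr_pchar2.
exists (w / c).
have : (w ^+ 2 + w * c + (c ^+ 2 + 1)) * (w + c) == 0.
  by rewrite quad_root.
rewrite mulf_eq0 (addr_eq0_char2 ch2 w c) (negbTE wc) orbF => /eqP h.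
apply/eqP; rewrite -(addr_eq0_char2 ch2).
have -> : (w / c) ^+ 2 + w / c + (1 + (c ^+ 2)^-1)
   = (w ^+ 2 + w * c + (c ^+ 2 + 1)) / c ^+ 2 by field.
by rewrite h mul0r.
Qed.

(** The map v |-> v^3 / (v + 1)^2 recovers a from the inverse v of a root. It
    preserves the trace, and it is injective where the trace differs from that
    of one because the cubic then has a single root; hence it is onto there. *)
Lemma chi_noroot (a : F) : a != 0 -> (forall z, ~~ cubic_root a z) ->
  chi r a = chi r (1 : F).
Proof.
move=> a0 noz; apply/eqP/negPn/negP => an1.
pose A := [set v : F | (v != 0) && (chi r v != chi r (1 : F))].
pose phi (v : F) := v ^+ 3 / (v + 1) ^+ 2.
have A1 v : v \in A -> v + 1 != 0.
  rewrite inE (addr_eq0_char2 ch2) => /andP[_]; apply: contraNneq => ->.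
  by rewrite eqxx.
have A0 v : v \in A -> v != 0 by rewrite inE => /andP[].
have phi0 v : v \in A -> phi v != 0.
  by move=> vA; rewrite /phi mulf_neq0 ?invr_eq0 ?expf_neq0 ?(A0 v) ?(A1 v).
have root_phi v : v \in A -> cubic_root (phi v) v^-1.
  move=> vA; have v0 := A0 v vA; have v1 := A1 v vA.
  rewrite /cubic_root /phi invfM invrK.
  have -> : v^-1 ^+ 3 + v^-1 + (v ^+ 3)^-1 * (v + 1) ^+ 2
      = (1 + v ^+ 2 + (v + 1) ^+ 2) / v ^+ 3 by field.
  have -> : 1 + v ^+ 2 + (v + 1) ^+ 2 = 0 by char2_ring ch2.
  by rewrite mul0r.
have phiA v : v \in A -> phi v \in A.
  move=> vA; have v0 := A0 v vA; have v1 := A1 v vA.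
  rewrite inE phi0 //=; move: vA; rewrite inE v0 /=.
  have -> : phi v = v + ((v + 1)^-1 + (v + 1)^-1 ^+ 2).
    have hv : v ^+ 3 = v * (v + 1) ^+ 2 + (v + 1 + 1) by char2_ring ch2.
    by rewrite /phi hv; field.
  rewrite !(chi_add cardF) -frob1E chi_frob // chi_sqr mulr1 //.
have phi_inj : {in A &, injective phi}.
  move=> v w vA wA vw; apply/eqP/negPn/negP => nvw.
  move: (vA); rewrite inE => /andP[_ /eqP]; apply; rewrite -[v]invrK.
  apply/(chi_inv_eq (phi0 v vA) (root_phi v vA)).
  by exists w^-1; [rewrite vw root_phi | rewrite (inj_eq invr_inj) eq_sym].
have phiAA : phi @: A = A.
  apply/eqP; rewrite eqEcard (card_in_imset phi_inj) leqnn andbT.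
  by apply/subsetP => _ /imsetP[v vA ->]; apply: phiA.
have : a \in phi @: A by rewrite phiAA inE a0.
case/imsetP => v vA av; have := noz v^-1.
by rewrite av root_phi.
Qed.

Lemma cubic_nrootsE (a : F) :
  cubic_nroots a = #|[set z : F | cubic_root a z]|.
Proof.
rewrite /cubic_nroots; apply: eq_card => z.
by rewrite !inE rootE !hornerE.
Qed.

Lemma cubic_nroots3 (a : F) : a != 0 -> cubic_nroots a = 3 ->
  exists2 c, cubic_root a c & chi r c^-1 = chi r (1 : F).
Proof.
rewrite cubic_nrootsE => a0 n3.
have : (1 < #|[set z : F | cubic_root a z]|)%N by rewrite n3.
case/card_gt1P => c [w []]; rewrite !inE => ac aw cw; exists c => //.
by apply/(chi_inv_eq a0 ac); exists w; rewrite // eq_sym.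
Qed.

Lemma cubic_nroots1 (a : F) : a != 0 -> cubic_nroots a = 1%N ->
  exists2 c, cubic_root a c & chi r c^-1 = - chi r (1 : F).
Proof.
rewrite cubic_nrootsE => a0 /eqP/cards1P[c cE].
have ac : cubic_root a c by have := set11 c; rewrite -cE inE.
exists c => //; have : chi r c^-1 <> chi r (1 : F).
  move/(chi_inv_eq a0 ac) => [w aw wc].
  have : w \in [set z : F | cubic_root a z] by rewrite inE.
  by rewrite cE inE (negbTE wc).
by rewrite /chi; do 2!case: ifP.
Qed.

Lemma cubic_nroots0 (a : F) : cubic_nroots a = 0%N ->
  forall z, ~~ cubic_root a z.
Proof.
rewrite cubic_nrootsE => /cards0_eq h z.
by have := in_set0 z; rewrite -h inE => ->.
Qed.

End CubicTraces.

(** * The number of points *)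

Lemma curve_rhs (L : fieldType) (ch2 : 2 \in [pchar L]) r (a x : L) :
  a * (x ^+ (2 ^ r.+1 + 1) + x ^+ (2 ^ r + 2) + x ^+ (2 ^ r + 1) + x ^+ 2)
  = quad r a a 0 x.
Proof.
rewrite expnS mulnC !exprD exprM -!frobE expr1 /quad /delta; char2_ring ch2.
Qed.

Lemma C3_cardE (L : finFieldType) r n (a : L) : #|L| = (2 ^ (r * n))%N ->
  (C3_card r a)%:Z = (2 ^ (r * n) + 1)%N%:Z + gsum r n a a 0.
Proof.
move=> cardL; have ch2 := char2_card cardL; rewrite /C3_card.
have -> : #|C3_affine r a|
    = (\sum_x #|[set y : L | (y ^+ 2 + y == quad r a a 0 x)%R]|)%N.
  rewrite -sum1_card; under [RHS]eq_bigr => x _ do rewrite -sum1_card.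
  rewrite pair_big_dep /=; apply: eq_bigl => -[x y].
  by rewrite !inE /= curve_rhs.
rewrite !PoszD addrAC; congr (_ + _).
rewrite (big_morph Posz PoszD (erefl _)) -cardL -[(#|L|)%:Z]natz -sumr_const.
rewrite -big_split; apply: eq_bigr => x _.
by rewrite (card_artin_schreier cardL).
Qed.

Section Values.

Variables (r n : nat) (F L : finFieldType).
Hypotheses (cardF : #|F| = (2 ^ r)%N) (cardL : #|L| = (2 ^ (r * n))%N).
Variables (iota : {rmorphism F -> L}) (alpha : F).
Hypothesis halpha : alpha != 0.

Let frobF (x : F) : frob r x = x := frob_card cardF x.
Let a := iota alpha.
Let a0 : a != 0. Proof. by rewrite fmorph_eq0. Qed.
Let ar : frob r a = a. Proof. by rewrite frob_rmorph frobF. Qed.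
Local Notation S := (gsum r n a a 0).

Lemma frob_fixed_image (x : L) : frob (r * 1) x = x -> exists y, x = iota y.
Proof.
rewrite muln1 => /eqP fx.
have : [set iota y | y : F] = [set x : L | frob r x == x].
  apply/eqP; rewrite eqEcard (card_frob_fixed cardL) ?dvdn_mulr //.
  rewrite card_imset ?cardF ?leqnn ?andbT; last exact: fmorph_inj.
  by apply/subsetP => _ /imsetP[y _ ->]; rewrite inE frob_rmorph frobF.
move/setP/(_ x); rewrite inE fx => /imsetP[y _ ->]; by exists y.
Qed.

Lemma rootedE : rooted r a = [exists c : F, cubic_root alpha c].
Proof.
rewrite (rooted_rmorph alpha frob_fixed_image).
by apply: eq_existsb => c; rewrite frobF eqxx.
Qed.

Lemma rooted_root (c : F) : cubic_root alpha c -> rooted r a.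
Proof. by move=> h; rewrite rootedE; apply/existsP; exists c. Qed.

Lemma gsum_value_odd : odd n ->
  S = root_coef (rooted r a) n * jacobi2 n ^+ r * 2 ^+ (r * (n + 1) %/ 2).
Proof.
move=> on; rewrite gsum_odd //; congr (_ * 2 ^+ _).
have h : (n + 1 = n.+1./2 * 2)%N by lia.
by rewrite h mulnA mulnK.
Qed.

Lemma gsum_value_2mod4 : (n %% 4 = 2)%N -> S = 0.
Proof.
move=> n4; have nE : n = (2 * n./2)%N by lia.
have cardL2 := cardL; rewrite nE in cardL2; rewrite nE.
by apply: gsum_2mod4 => //; lia.
Qed.

Lemma gsum_value_rooted (c : F) : cubic_root alpha c -> (n %% 4 = 0)%N ->
  S = - (chi r (1 : F) ^+ (n %/ 4) + chi r c^-1 ^+ (n %/ 4))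
      * 2 ^+ (r * (n + 2) %/ 2).
Proof.
move=> ac n4; have nE : n = (4 * (n %/ 4))%N by lia.
have cardL4 := cardL; rewrite nE in cardL4.
have expE : (r * (n + 2) %/ 2 = r * (2 * (n %/ 4)).+1)%N.
  have h : (n + 2 = (2 * (n %/ 4)).+1 * 2)%N by lia.
  by rewrite h mulnA mulnK.
have iac : cubic_root a (iota c).
  by rewrite /cubic_root -fmorphV -rmorphXn -!rmorphD fmorph_eq0.
have icr : frob r (iota c) = iota c by rewrite frob_rmorph frobF.
have chi1 : chi r (1 : L) = chi r (1 : F).
  by rewrite -(rmorph1 iota); apply: chi_rmorph.
have chic : chi r (iota c)^-1 = chi r c^-1.
  by rewrite -fmorphV; apply: chi_rmorph.
rewrite expE {1}nE (gsum_root_4k cardL4 a0 icr iac) chi1 chic.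
by rewrite -[(2 ^ _)%:Z]natz natrX.
Qed.

Lemma gsum_value_noroot : (forall c, ~~ cubic_root alpha c) -> (n %% 4 = 0)%N ->
  S = root_coef false n * chi r (1 : F) ^+ (n %/ 4)
      * 2 ^+ (r * (n + 2) %/ 2).
Proof.
move=> noc n4; have nE : n = (4 * (n %/ 4))%N by lia.
have cardL4 := cardL; rewrite nE in cardL4.
have expE : (r * (n + 2) %/ 2 = r * (2 * (n %/ 4)).+1)%N.
  have h : (n + 2 = (2 * (n %/ 4)).+1 * 2)%N by lia.
  by rewrite h mulnA mulnK.
have nr : ~~ rooted r a.
  by rewrite rootedE negb_exists; apply/forallP.
rewrite expE {1 2}nE (gsum_noroot cardL4 a0 ar nr).
have chia : chi r a = chi r alpha by apply: chi_rmorph.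
by rewrite -(chi_noroot cardF halpha noc) chia.
Qed.

End Values.

Lemma sign_exp (s : int) k : s * s = 1 -> s ^+ k = if odd k then s else 1.
Proof.
move=> ss; rewrite -[in LHS](odd_double_half k) exprD -muln2 mulnC exprM expr2.
by rewrite ss expr1n mulr1; case: (odd k).
Qed.

Lemma residues8 n c : (n %% 8 = c)%N ->
  [/\ odd n = odd c, (n %% 4 = c %% 4)%N & odd (n %/ 4) = odd (c %/ 4)].
Proof. by split; lia. Qed.

Lemma residues24 n c : (n %% 24 = c)%N ->
  (n %% 8 = c %% 8)%N /\ (3 %| n)%N = (3 %| c)%N.
Proof. by split; lia. Qed.

Ltac residue := rewrite !inE; repeat case/orP; move/eqP.

Ltac conclude :=
  rewrite ?exprD ?expr1; move: (2 ^+ (_ %/ 2)) => ?; ring.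

Theorem theorem7 (r n : nat) (hr : (1 <= r)%N) (hn : (1 <= n)%N)
    (F L : finFieldType) (cardF : #|F| = (2 ^ r)%N)
    (cardL : #|L| = (2 ^ (r * n))%N) (iota : {rmorphism F -> L})
    (alpha : F) (halpha : alpha != 0) (D : int)
    (hD : (C3_card r (iota alpha))%:Z = (2 ^ (r * n) + 1)%N%:Z + D) :
  (odd r -> cubic_nroots alpha = 3%N ->
    ((n %% 8)%N \in [:: 1; 7]%N -> D = 2 ^+ (r * (n + 1) %/ 2)%N) /\
    ((n %% 8)%N \in [:: 3; 5]%N -> D = - (2 ^+ (r * (n + 1) %/ 2)%N)) /\
    ((n %% 8)%N \in [:: 2; 6]%N -> D = 0) /\
    ((n %% 8)%N \in [:: 4]%N -> D = 2 ^+ (r * (n + 2) %/ 2 + 1)%N) /\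
    ((n %% 8)%N \in [:: 0]%N -> D = - (2 ^+ (r * (n + 2) %/ 2 + 1)%N))) /\
  (~~ odd r -> cubic_nroots alpha = 3%N ->
    ((n %% 8)%N \in [:: 1; 3; 5; 7]%N -> D = 2 ^+ (r * (n + 1) %/ 2)%N) /\
    ((n %% 8)%N \in [:: 2; 6]%N -> D = 0) /\
    ((n %% 8)%N \in [:: 0; 4]%N -> D = - (2 ^+ (r * (n + 2) %/ 2 + 1)%N))) /\
  (odd r -> cubic_nroots alpha = 1%N ->
    ((n %% 8)%N \in [:: 1; 7]%N -> D = 2 ^+ (r * (n + 1) %/ 2)%N) /\
    ((n %% 8)%N \in [:: 3; 5]%N -> D = - (2 ^+ (r * (n + 1) %/ 2)%N)) /\
    ((n %% 8)%N \in [:: 2; 4; 6]%N -> D = 0) /\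
    ((n %% 8)%N \in [:: 0]%N -> D = - (2 ^+ (r * (n + 2) %/ 2 + 1)%N))) /\
  (~~ odd r -> cubic_nroots alpha = 1%N ->
    ((n %% 8)%N \in [:: 1; 3; 5; 7]%N -> D = 2 ^+ (r * (n + 1) %/ 2)%N) /\
    ((n %% 8)%N \in [:: 2; 4; 6]%N -> D = 0) /\
    ((n %% 8)%N \in [:: 0]%N -> D = - (2 ^+ (r * (n + 2) %/ 2 + 1)%N))) /\
  (odd r -> cubic_nroots alpha = 0%N ->
    ((n %% 24)%N \in [:: 1; 7; 17; 23]%N -> D = 2 ^+ (r * (n + 1) %/ 2)%N) /\
    ((n %% 24)%N \in [:: 5; 11; 13; 19]%N ->
       D = - (2 ^+ (r * (n + 1) %/ 2)%N)) /\
    ((n %% 24)%N \in [:: 3; 21]%N -> D = 2 ^+ (r * (n + 1) %/ 2 + 1)%N) /\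
    ((n %% 24)%N \in [:: 9; 15]%N -> D = - (2 ^+ (r * (n + 1) %/ 2 + 1)%N)) /\
    ((n %% 24)%N \in [:: 2; 6; 10; 14; 18; 22]%N -> D = 0) /\
    ((n %% 24)%N \in [:: 4; 20]%N -> D = - (2 ^+ (r * (n + 2) %/ 2)%N)) /\
    ((n %% 24)%N \in [:: 8; 16]%N -> D = 2 ^+ (r * (n + 2) %/ 2)%N) /\
    ((n %% 24)%N \in [:: 12]%N -> D = 2 ^+ (r * (n + 2) %/ 2 + 1)%N) /\
    ((n %% 24)%N \in [:: 0]%N -> D = - (2 ^+ (r * (n + 2) %/ 2 + 1)%N))) /\
  (~~ odd r -> cubic_nroots alpha = 0%N ->
    ((n %% 24)%N \in [:: 1; 5; 7; 11; 13; 17; 19; 23]%N ->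
       D = 2 ^+ (r * (n + 1) %/ 2)%N) /\
    ((n %% 24)%N \in [:: 3; 9; 15; 21]%N ->
       D = - (2 ^+ (r * (n + 1) %/ 2 + 1)%N)) /\
    ((n %% 24)%N \in [:: 2; 6; 10; 14; 18; 22]%N -> D = 0) /\
    ((n %% 24)%N \in [:: 4; 8; 16; 20]%N -> D = 2 ^+ (r * (n + 2) %/ 2)%N) /\
    ((n %% 24)%N \in [:: 0; 12]%N -> D = - (2 ^+ (r * (n + 2) %/ 2 + 1)%N))).
Proof.
pose a := iota alpha; have DS : D = gsum r n a a 0.
  by move: hD; rewrite (C3_cardE _ cardL) => /addrI.
have chi1 := chi_one cardF.
have Vodd : odd n -> D = root_coef (rooted r a) n
    * (if odd r then jacobi2 n else 1) * 2 ^+ (r * (n + 1) %/ 2).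
  by rewrite DS -sign_exp ?jacobi2_sqr //; apply: (gsum_value_odd cardF).
have V2 : (n %% 4 = 2)%N -> D = 0.
  by rewrite DS; apply: (gsum_value_2mod4 cardF).
have rooted_values c : cubic_root alpha c ->
    (odd n -> D = (if odd r then jacobi2 n else 1) * 2 ^+ (r * (n + 1) %/ 2))
    /\ ((n %% 4 = 0)%N -> D
         = - (if odd (n %/ 4) then chi r (1 : F) + chi r c^-1 else 2)
           * 2 ^+ (r * (n + 2) %/ 2)).
  move=> ac; split=> [on|hn4].
    rewrite Vodd // (rooted_root cardF cardL iota ac) /root_coef.
    by rewrite mul1r.
  rewrite DS (gsum_value_rooted cardF cardL iota halpha ac hn4).
  by rewrite !(sign_exp _ (chi_sqr _ _)); case: ifP.
have noroot_values : cubic_nroots alpha = 0%N ->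
    (odd n -> D = root_coef false n * (if odd r then jacobi2 n else 1)
                  * 2 ^+ (r * (n + 1) %/ 2))
    /\ ((n %% 4 = 0)%N -> D
         = root_coef false n * (if odd (n %/ 4) then chi r (1 : F) else 1)
           * 2 ^+ (r * (n + 2) %/ 2)).
  move=> n0; have noc := cubic_nroots0 n0.
  split=> [on|hn4].
    have nr : rooted r a = false.
      rewrite (rootedE cardF cardL); apply/negbTE.
      by rewrite negb_exists; apply/forallP.
    by rewrite Vodd // nr.
  rewrite DS (gsum_value_noroot cardF cardL iota halpha noc hn4).
  by rewrite sign_exp ?chi_sqr.
split; last split; last split; last split; last split.
- move=> or /(cubic_nroots3 cardF halpha)[c ac cc].
  have [Vo V0] := rooted_values c ac.
  rewrite cc chi1 or in V0; rewrite or in Vo.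
  by do 4?split; residue => h; have [o4 m4 k4] := residues8 h; first
    [ by rewrite Vo ?o4 // /jacobi2 h /=; conclude
    | by rewrite V2 ?m4
    | by rewrite V0 ?m4 // k4 /=; conclude ].
- move=> /negbTE or /(cubic_nroots3 cardF halpha)[c ac cc].
  have [Vo V0] := rooted_values c ac.
  rewrite cc chi1 or in V0; rewrite or in Vo.
  by do 2?split; residue => h; have [o4 m4 k4] := residues8 h; first
    [ by rewrite Vo ?o4 //; conclude
    | by rewrite V2 ?m4
    | by rewrite V0 ?m4 // k4 /=; conclude ].
- move=> or /(cubic_nroots1 cardF halpha)[c ac cc].
  have [Vo V0] := rooted_values c ac.
  rewrite cc chi1 or in V0; rewrite or in Vo.
  by do 3?split; residue => h; have [o4 m4 k4] := residues8 h; first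
    [ by rewrite Vo ?o4 // /jacobi2 h /=; conclude
    | by rewrite V2 ?m4
    | by rewrite V0 ?m4 // k4 /=; conclude ].
- move=> /negbTE or /(cubic_nroots1 cardF halpha)[c ac cc].
  have [Vo V0] := rooted_values c ac.
  rewrite cc chi1 or in V0; rewrite or in Vo.
  by do 2?split; residue => h; have [o4 m4 k4] := residues8 h; first
    [ by rewrite Vo ?o4 //; conclude
    | by rewrite V2 ?m4
    | by rewrite V0 ?m4 // k4 /=; conclude ].
- move=> or /noroot_values[Vo V0]; rewrite chi1 or in V0; rewrite or in Vo.
  by do 8?split; residue => h; have [h8 h3] := residues24 h;
    have [o4 m4 k4] := residues8 h8; first
    [ by rewrite Vo ?o4 // /jacobi2 h8 /root_coef h3 /=; conclude
    | by rewrite V2 ?m4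
    | by rewrite V0 ?m4 // k4 /root_coef h3 /=; conclude ].
- move=> /negbTE or /noroot_values[Vo V0].
  rewrite chi1 or in V0; rewrite or in Vo.
  by do 4?split; residue => h; have [h8 h3] := residues24 h;
    have [o4 m4 k4] := residues8 h8; first
    [ by rewrite Vo ?o4 // /root_coef h3 /=; conclude
    | by rewrite V2 ?m4
    | by rewrite V0 ?m4 // k4 /root_coef h3 /=; conclude ].
Qed.
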